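(* Let $a,b:[0,+\infty)\to\mathbb R$ be Lebesgue measurable and essentially bounded, and let $g,h:[0,+\infty)\to\mathbb R$ be Lebesgue measurable and locally essentially bounded, with $g(t)\le t$, $h(t)\le t$, $\lim_{t\to+\infty}g(t)=+\infty$, $\lim_{t\to+\infty}h(t)=+\infty$, and such that for every Lebesgue null set $U\subset\mathbb R$ the sets $g^{-1}(U)$ and $h^{-1}(U)$ are Lebesgue null. Let $b(t)\ge0$. Assume that for some $t_0\ge 0$ and constants $a_0<1$, $\delta>0$, $\tau>0$, $b_0>0$ one has $\|a\|_{[t_0,+\infty)}\le a_0<1$ and, for $t\ge t_0$, $t-g(t)\le\delta$, $t-h(t)\le\tau$, $b(t)\ge b_0>0$, and that at least one of the following conditions holds: (i) $$\left\|\frac{b-\beta}{\beta}\right\|_{[t_0,+\infty)}+\left\|\frac{b}{\beta}\right\|_{[t_0,+\infty)}\frac{\|a\|_{[t_0,+\infty)}}{1-\|a\|_{[t_0,+\infty)}}<1,\qquad\text{where }\beta(t)=\min\left\{b(t),\frac1{\tau e}\right\};$$ (ii) $$\|b\|_{[t_0,+\infty)}\left\|\left(t-h(t)-\frac{1}{\|b\|_{[t_0,+\infty)}\,e}\right)^+\right\|_{[t_0,+\infty)}<1-2\|a\|_{[t_0,+\infty)} .$$ Then the equation $$(x(t)-a(t)x(g(t)))'+b(t)x(h(t))=0$$ is exponentially stable.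
   Context: Notation: $\|u\|_{[t_0,+\infty)}=\operatorname{ess\,sup}_{t\ge t_0}|u(t)|$ and $u^+=\max\{u,0\}$. Equalities and inequalities between measurable functions are understood for almost every $t$; the function $a$ is represented by an everywhere defined function with $|a(t)|\le\|a\|_{[t_0,+\infty)}$ for all $t\ge t_0$. Solution: for an initial point $\sigma\ge t_0$ and a bounded Borel measurable initial function $\varphi:(-\infty,\sigma]\to\mathbb R$, a solution of the initial value problem $$(x(t)-a(t)x(g(t)))'+b(t)x(h(t))=0,\ t\ge\sigma,\qquad x(t)=\varphi(t),\ t\le\sigma,$$ is a Lebesgue measurable function $x:\mathbb R\to\mathbb R$, locally essentially bounded on $[\sigma,+\infty)$, such that $t\mapsto x(t)-a(t)x(g(t))$ is locally absolutely continuous on $[\sigma,+\infty)$, the differential equation holds for almost all $t\ge\sigma$, and $x(t)=\varphi(t)$ for $t\le\sigma$. (Such a solution exists and is unique.) Exponential stability: the equation is (uniformly) exponentially stable if there are $M>0$, $\gamma>0$, independent of $\sigma\ge t_0$ and $\varphi$, such that every such solution satisfies $|x(t)|\le Me^{-\gamma(t-\sigma)}\sup_{r\in(-\infty,\sigma]}|\varphi(r)|$ for (almost all) $t\ge\sigma$.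
   Formalization: The inequality g(t) ≤ t is required for every t ≥ 0 rather than almost every t; if it fails on a null set, the value of x(t)-a(t)x(g(t)) at σ is not determined by φ, and nonzero solutions with φ = 0 exist. *)

(* Defs.v *)
From mathcomp Require Import all_boot all_order all_algebra.
From mathcomp Require Import all_classical all_reals all_analysis.
From mathcomp Require Import measurable_realfun ess_sup_inf.

Set Implicit Arguments.
Unset Strict Implicit.
Unset Printing Implicit Defensive.

Import Order.TTheory GRing.Theory Num.Theory.
Import numFieldNormedType.Exports.

Local Open Scope classical_set_scope.
Local Open Scope ring_scope.

(* Functions on [0, +oo[ are total functions R -> R of which only the values on
   [0, +oo[ are constrained.
   [lebesgue_measure] lives on the Borel sigma-algebra; a set is negligible for
   it when it is included in a Borel set of measure 0, so negligible sets (and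
   the notation [\ae]) are exactly the Lebesgue null sets (and "for almost
   every" in the sense of Lebesgue). *)

(* The source carries the completed (Lebesgue) sigma-algebra, the target the
   Borel one. *)
Definition lebesgue_measurable_fun (R : realType) (D : set R) (f : R -> R) :
    Prop :=
  @measurable_fun _ _
    (g_sigma_algebraType (completed_algebra_gen (@lebesgue_measure R)))
    (measurableTypeR R) D f.

(* Restricting |u| by 0 outside D does not change its essential supremum over
   D, except when D is null, where this gives 0. *)
Definition ess_norm (R : realType) (D : set R) (u : R -> R) : \bar R :=
  ess_sup (@lebesgue_measure R) ((fun t => `|u t|%:E) \_ D).

Definition ess_bounded (R : realType) (D : set R) (u : R -> R) : Prop :=
  (ess_norm D u < +oo)%E.

Definition locally_ess_bounded (R : realType) (c : R) (u : R -> R) : Prop :=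
  forall d : R, ess_bounded `[c, d] u.

Definition abs_continuous (R : realType) (c d : R) (f : R -> R) : Prop :=
  forall e : R, 0 < e -> exists2 r : R, 0 < r &
    forall (n : nat) (u v : 'I_n -> R),
      (forall i, [/\ c <= u i, u i <= v i & v i <= d]) ->
      trivIset [set: 'I_n] (fun i => `]u i, v i[%classic) ->
      \sum_(i < n) (v i - u i) < r ->
      \sum_(i < n) `|f (v i) - f (u i)| < e.

Definition locally_abs_continuous (R : realType) (c : R) (f : R -> R) : Prop :=
  forall d : R, abs_continuous c d f.

Definition null_preimages (R : realType) (g : R -> R) : Prop :=
  forall U : set R, (@lebesgue_measure R).-negligible U ->
    (@lebesgue_measure R).-negligible (`[0, +oo[ `&` g @^-1` U).

Definition initial_function (R : realType) (sigma : R) (phi : R -> R) : Prop :=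
  measurable_fun `]-oo, sigma] phi /\ [bounded phi r | r in `]-oo, sigma]].

(* x solves (x(t) - a(t) x(g(t)))' + b(t) x(h(t)) = 0 for t >= sigma, with
   x = phi on ]-oo, sigma]. *)
Definition is_solution (R : realType) (a b g h : R -> R) (sigma : R)
    (phi x : R -> R) : Prop :=
  let y : R -> R := fun t => x t - a t * x (g t) in
  [/\ lebesgue_measurable_fun [set: R] x,
      locally_ess_bounded sigma x,
      locally_abs_continuous sigma y,
      (\forall t \ae @lebesgue_measure R, sigma <= t ->
         derivable y t 1 /\ derive1 y t + b t * x (h t) = 0) &
      (forall t, t <= sigma -> x t = phi t)].

Definition exponentially_stable (R : realType) (t0 : R) (a b g h : R -> R) :
    Prop :=
  exists M gamma : R, [/\ 0 < M, 0 < gamma &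
    forall (sigma : R) (phi x : R -> R), t0 <= sigma ->
      initial_function sigma phi -> is_solution a b g h sigma phi x ->
      \forall t \ae @lebesgue_measure R, sigma <= t ->
        `|x t| <= M * expR (- gamma * (t - sigma)) *
                  sup [set `|phi r| | r in `]-oo, sigma]]].

(* Main.v *)
Require Import Defs.
From mathcomp Require Import all_boot all_order all_algebra.
From mathcomp Require Import all_classical all_reals all_analysis.
From mathcomp Require Import measurable_realfun ess_sup_inf.
From mathcomp Require Import ring lra.

Set Implicit Arguments.
Unset Strict Implicit.
Unset Printing Implicit Defensive.

Import Order.TTheory GRing.Theory Num.Theory.
Import numFieldNormedType.Exports.

Local Open Scope classical_set_scope.
Local Open Scope ring_scope.

(** Put [y t = x t - a t * x (g t)] and let [w t = expR (- gam * (t - sigma))]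
    for a small rate [gam > 0].  The proof is a small-gain argument in the
    weight [w]: a bound [Y * w] of [y] and a bound [S * w] of [x] are played
    against each other until they reproduce themselves with a factor below 1.

    From [y] to [x]: as [norm_a < 1], the relation [x = y + a * x(g)] is a
    contraction for [x], so that [|y| <= Y * w] forces [|x| <= S * w] with [S]
    close to [Y / (1 - norm_a)], up to a multiple of the bound [Phi] of the
    initial function (lemma [neutral_bound]).

    From [x] back to [y]: the equation [y' = - b * x(h)] is written as
    [y' = - p * (y(k) - f)], a scalar delay equation with delay [k], coefficient
    [p] and forcing term [f = y(k) - (b / p) * x(h)].  The pair [(k, p)] is
    chosen so that coefficient times delay is at most [1 / e]; this is the
    classical condition under which a delay equation preserves positivity, and
    it makes the equation as good as the ordinary differential equation
    [y' = - p * (y - f)]: a bound [F * w] of [f] yields essentially the bound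
    [F * w] of [y] (lemmas [delay_supersolution_ge0] and
    [delay_equation_decay]).  Since [x(h) = y(h) + a(h) * x(g(h))], the two
    conditions of the theorem come from two choices of [(k, p)]:
    - under (i), [k = h] and [p = beta], so that
      [f = - ((b - beta) / beta) * y(h) - (b / beta) * a(h) * x(g(h))];
    - under (ii), [p = b] and [k] is the delay [h] cut off at the admissible
      length, so that [f = y(k) - y(h) - a(h) * x(g(h))], and [y(k) - y(h)] is
      estimated by [|y'| <= norm_b * |x(h)|] times the excess [k - h].
    In both cases [|f| <= (N1 * Y + N2 * S) * w] up to a factor that tends to 1
    with [gam], and the hypothesis says that [N1 + N2 / (1 - norm_a) < 1].  This
    closes the loop for a small [gam] (lemma [solution_decay]), with a
    constant that depends neither on the solution nor on [sigma].

    Differential inequalities are only known almost everywhere, and they are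
    integrated without integrals: an absolutely continuous function with a
    nonnegative derivative almost everywhere is nondecreasing
    ([abs_continuous_nondecreasing]), which follows from Cousin's lemma. *)

(** * Absolutely continuous functions with a derivative of known sign *)

Lemma ae_mono (R : realType) (P Q : R -> Prop) : (forall t, P t -> Q t) ->
  (\forall t \ae @lebesgue_measure R, P t) ->
  \forall t \ae @lebesgue_measure R, Q t.
Proof.
have F := ae_filter_ringOfSetsType (@lebesgue_measure R).
by move=> PQ; apply: filterS => t; exact: PQ.
Qed.

Lemma ae_and (R : realType) (P Q : R -> Prop) :
  (\forall t \ae @lebesgue_measure R, P t) ->
  (\forall t \ae @lebesgue_measure R, Q t) ->
  \forall t \ae @lebesgue_measure R, P t /\ Q t.
Proof.
have F := ae_filter_ringOfSetsType (@lebesgue_measure R).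
exact: filterI.
Qed.

(** Cousin's lemma.  The supremum of the points that a subdivision can reach is
    itself reached, and can be passed unless it is [d]. *)
Lemma cousin_chain (R : realType) (c d : R) (step : R -> R -> Prop) :
  c <= d ->
  (forall x, c <= x <= d -> exists2 e : R, 0 < e &
     forall u v, c <= u -> u <= x -> x <= v -> v <= d -> v - u < e ->
       step u v) ->
  exists n (t : nat -> R), [/\ t 0%N = c, t n = d &
    forall i, (i < n)%N -> t i <= t i.+1 /\ step (t i) (t i.+1)].
Proof.
move=> cd loc.
pose S := [set s : R | c <= s <= d /\ exists n (t : nat -> R),
  [/\ t 0%N = c, t n = s &
    forall i, (i < n)%N -> t i <= t i.+1 /\ step (t i) (t i.+1)]].
have Sc : S c.
  by split; [rewrite lexx|exists 0%N, (fun=> c); split].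
have Sub : ubound S d by move=> s [/andP[]].
have hS : has_sup S by split; [exists c|exists d].
have cx : c <= sup S by exact: ub_le_sup (ex_intro _ d Sub) _ Sc.
have xd : sup S <= d by apply: ge_sup => //; exists c.
have [e e0 he] := loc (sup S) ltac:(by rewrite cx xd).
have [s Ss xs] := sup_adherent (divr_gt0 e0 (ltr0n R 2)) hS.
have sx : s <= sup S by exact: ub_le_sup (ex_intro _ d Sub) _ Ss.
case: (Ss) => /andP[cs sd] [n [t [t0 tn tS]]].
pose v := Num.min d (sup S + e / 4).
have xv : sup S <= v by rewrite /v le_min xd/= lerDl divr_ge0// ltW.
have vd : v <= d by rewrite /v ge_min lexx.
have vle : v <= sup S + e / 4 by rewrite /v ge_min lexx orbT.
have Sv : S v.
  split; first by rewrite (le_trans cx xv).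
  exists n.+1, (fun i => if (i <= n)%N then t i else v); split => //.
    by rewrite ltnn.
  move=> i; rewrite ltnS leq_eqVlt => /predU1P[->|ilt] /=.
    rewrite eqxx ltnn tn/=; split; first exact: le_trans xv.
    by apply: he => //; lra.
  by rewrite ilt orbT; exact: tS.
have vx : v <= sup S by exact: ub_le_sup (ex_intro _ d Sub) _ Sv.
have vd' : v = d.
  have xvE : sup S = v by apply/eqP; rewrite eq_le xv.
  move: xvE; rewrite /v /Num.min; case: ifP => // _ h; exfalso; lra.
by rewrite -vd'; case: Sv.
Qed.

Lemma derive_ge0_local (R : realType) (f : R -> R) (x e : R) : 0 < e ->
  (exists2 df : R, is_derive x 1 f df & 0 <= df) ->
  exists2 r : R, 0 < r & forall u v, u <= x -> x <= v -> v - u < r ->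
    - e * (v - u) <= f v - f u.
Proof.
move=> e0 [df [fx /esym dfE]]; rewrite dfE => f0.
have : h^-1 *: (f (h *: 1 + x) - f x) @[h --> 0^'] --> 'D_1 f x by exact: fx.
move=> /cvgrPdist_lt /(_ e e0) /nbhs_ballP[r /= r0 hr].
(* The sign of [h] turns the bound on the difference quotient into a bound on
   the increment that serves on both sides of [x]. *)
have key h : `|h| < r -> - e * `|h| <= Num.sg h * (f (h + x) - f x).
  have [->|h0] := eqVneq h 0.
    by rewrite normr0 sgr0 mulr0 mul0r.
  move=> hlt; have := hr h; rewrite /ball/= sub0r normrN => /(_ hlt h0).
  rewrite /GRing.scale/= mulr1 => hd.
  have {hd} : - e <= h^-1 * (f (h + x) - f x).
    by move: hd; rewrite ltr_norml => /andP[_]; lra.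
  move=> /(ler_wpM2r (normr_ge0 h)) /le_trans; apply.
  by rewrite normrEsg mulrAC mulrCA mulVf// mulr1.
exists r => // u v ux xv uv.
have := key (v - x); have := key (u - x); rewrite !subrK.
rewrite (ger0_norm (_ : 0 <= v - x)) ?subr_ge0// distrC.
rewrite (ger0_norm (_ : 0 <= x - u)) ?subr_ge0//.
have xr : x - u < r by lra. have vr : v - x < r by lra.
move=> /(_ xr) k1 /(_ vr) k2.
have {}k1 : - e * (x - u) <= f x - f u.
  move: ux; rewrite le_eqVlt => /predU1P[->|ux]; first by rewrite !subrr mulr0.
  by move: k1; rewrite ltr0_sg ?subr_lt0// mulN1r opprB.
have {}k2 : - e * (v - x) <= f v - f x.
  move: xv; rewrite le_eqVlt => /predU1P[->|xv]; first by rewrite !subrr mulr0.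
  by move: k2; rewrite gtr0_sg ?subr_gt0// mul1r.
have -> : - e * (v - u) = - e * (x - u) + - e * (v - x) by ring.
lra.
Qed.

Lemma chain_le (R : realType) (t : nat -> R) n :
  (forall i, (i < n)%N -> t i <= t i.+1) ->
  forall i j, (i <= j)%N -> (j <= n)%N -> t i <= t j.
Proof.
move=> h i; elim=> [|j ih]; first by rewrite leqn0 => /eqP->.
rewrite leq_eqVlt => /predU1P[->//|]; rewrite ltnS => ij jn.
by apply: le_trans (h _ jn); exact: ih (ltnW jn).
Qed.

Lemma negligible_open_cover (R : realType) (N : set R) (e : R) : 0 < e ->
  (@lebesgue_measure R).-negligible N ->
  exists U : set R, [/\ open U, N `<=` U & (lebesgue_measure U < e%:E)%E].
Proof.
move=> e0 [A [mA A0 NA]].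
have [|U [oU AU UA]] := @lebesgue_regularity_outer R A e mA _ e0.
  by apply: le_lt_trans (ltry 0); rewrite -[leRHS]A0.
exists U; split => //; first exact: subset_trans AU.
apply: le_lt_trans UA; rewrite -[leRHS]add0e -[X in (X + _)%E]A0.
rewrite -{1}(setDUK AU); apply: measureU2 => //.
by apply: measurableD => //; exact: open_measurable.
Qed.

(** Subdivide [c, d] by Cousin's lemma: around a point with a derivative,
    [f] decreases at most at the rate [e1]; the other points lie in an open set
    [U] of small measure, and the intervals inside [U] contribute little by
    absolute continuity. *)
Lemma abs_continuous_nondecreasing (R : realType) (c d : R) (f : R -> R) :
  c <= d -> abs_continuous c d f ->
  (\forall t \ae @lebesgue_measure R, c <= t <= d ->
     exists2 df : R, is_derive t 1 f df & 0 <= df) ->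
  f c <= f d.
Proof.
move=> cd acf df; rewrite -subr_ge0; apply/ler_addgt0Pl => e e0.
rewrite addrC -lerBlDl sub0r.
pose e1 := e / 2 / (d - c + 1).
have dc1 : 0 < d - c + 1 by rewrite ltr_wpDl// subr_ge0.
have e10 : 0 < e1 by rewrite !divr_gt0.
have [r r0 hr] := acf _ (divr_gt0 e0 (ltr0n R 2)).
have [U [oU NU Ur]] := negligible_open_cover r0 df.
pose step u v := `]u, v[ `<=` U \/ - e1 * (v - u) <= f v - f u.
have [|n [t [t0 tn ht]]] := @cousin_chain R c d step cd.
  move=> x cxd; have [Ux|nUx] := pselect (U x).
    move: oU; rewrite openE => /(_ _ Ux) /nbhs_ballP[s /= s0 hs].
    exists s => // u v cu ux xv vd uv; left => z /=.
    rewrite in_itv/= => /andP[uz zv].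
    by apply: hs; rewrite /ball/= ltr_norml; apply/andP; split; lra.
  have dx : exists2 df : R, is_derive x 1 f df & 0 <= df.
    by apply: contrapT => h; apply: nUx; apply: NU => /= /(_ cxd).
  have [s s0 hs] := derive_ge0_local e10 dx.
  by exists s => // u v _ ux xv _ uv; right; exact: hs.
have tle : forall i j, (i <= j)%N -> (j <= n)%N -> t i <= t j.
  by apply: chain_le => i /ht[].
(* An interval that [U] does not contain is shrunk to a point, so that it does
   not count in the sum that absolute continuity controls. *)
pose mk i := `[< `]t i, t i.+1[ `<=` U >].
pose u (i : 'I_n) := t i.
pose v (i : 'I_n) := if mk i then t i.+1 else t i.
have uv i : u i <= v i by rewrite /u /v; case: ifP => // _; exact: tle.
have vle i : v i <= t i.+1 by rewrite /v; case: ifP => // _; exact: tle.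
have Itv i : `]u i, v i[ `<=` U.
  rewrite /u /v; case: ifPn => [/asboolP//|_] z /=.
  by rewrite in_itv/= => /andP[/lt_trans/[apply]]; rewrite ltxx.
have lt_itv (i j : 'I_n) z : (i < j)%N -> `]u i, v i[%classic z ->
    `]u j, v j[%classic z -> False.
  move=> ij /=; rewrite !in_itv/= => /andP[_ zi] /andP[zj _].
  have : v i <= u j by apply: le_trans (vle _) _; apply: tle => //; exact: ltnW.
  by rewrite leNgt (lt_trans zj zi).
have tI : trivIset [set: 'I_n] (fun i => `]u i, v i[%classic).
  move=> i j _ _ [z [zi zj]]; apply/val_inj/eqP/contraT => /=.
  by rewrite neq_ltn => /orP[ij|ji]; exfalso;
    [apply: lt_itv ij zi zj|apply: lt_itv ji zj zi].
have suv : \sum_(i < n) (v i - u i) < r.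
  rewrite -lte_fin; apply: le_lt_trans Ur.
  have -> : ((\sum_(i < n) (v i - u i))%:E =
      lebesgue_measure (\big[setU/set0]_(i < n) `]u i, v i[%classic))%E.
    rewrite measure_semi_additive_ord//; last exact: bigsetU_measurable.
    rewrite -sumEFin; apply: eq_bigr => i _.
    rewrite [RHS]lebesgue_measure_itv/= lte_fin.
    case: ltP => // h; suff -> : v i = u i by rewrite subrr.
    by apply/eqP; rewrite eq_le h uv.
  apply: le_measure; rewrite ?inE.
  - by apply: bigsetU_measurable.
  - exact: open_measurable.
  - by apply: (big_ind (fun A => A `<=` U)) => // A B AU BU z [/AU|/BU].
have {}hr := hr n u v _ tI suv.
have {}hr : \sum_(i < n) `|f (v i) - f (u i)| < e / 2.
  apply: hr => i; split => //; last first.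
    by apply: le_trans (vle i) _; rewrite -tn; apply: tle.
  by rewrite -t0; apply: tle => //; exact: ltnW.
have : \sum_(i < n) (- e1 * (t i.+1 - t i) - `|f (v i) - f (u i)|) <=
    \sum_(i < n) (f (t i.+1) - f (t i)).
  apply: ler_sum => i _; have [tii [|h]] := ht i (ltn_ord i).
    move=> h; rewrite /u /v /mk asboolT//.
    rewrite -lerBlDr opprK -subr_ge0.
    have h1 : 0 <= e1 * (t i.+1 - t i) by rewrite mulr_ge0 ?subr_ge0// ltW.
    have := ler_norm (f (t i) - f (t i.+1)); rewrite distrC; lra.
  by apply: le_trans h; rewrite gerBl.
rewrite big_split/= -mulr_sumr sumrN.
rewrite -(big_mkord xpredT (fun i => t i.+1 - t i)).
rewrite -(big_mkord xpredT (fun i => f (t i.+1) - f (t i))).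
rewrite (telescope_sumr (f \o t))// telescope_sumr//= t0 tn.
have : e1 * (d - c) <= e / 2.
  rewrite /e1 mulrAC ler_pdivrMr// ler_wpM2l//; last by rewrite lerDl.
  by rewrite divr_ge0// ltW.
by rewrite mulNr; lra.
Qed.

(** * Closure properties and comparison of increments *)

Section absolute_continuity.
Context {R : realType}.
Implicit Types (c d : R) (f g : R -> R).

Lemma abs_continuousS c d c' d' f : c <= c' -> d' <= d ->
  abs_continuous c d f -> abs_continuous c' d' f.
Proof.
move=> cc dd acf e e0; have [r r0 hr] := acf e e0.
exists r => // n u v uv; apply: hr => i; have [cu ui vd] := uv i.
by split => //; [exact: le_trans cu|exact: le_trans dd].
Qed.

Lemma abs_continuousD c d f g : abs_continuous c d f ->
  abs_continuous c d g -> abs_continuous c d (fun t => f t + g t).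
Proof.
move=> acf acg e e0.
have [r r0 hr] := acf _ (divr_gt0 e0 (ltr0n R 2)).
have [s s0 hs] := acg _ (divr_gt0 e0 (ltr0n R 2)).
exists (Num.min r s); first by rewrite lt_min r0.
move=> n u v uv tI; rewrite lt_min.
move=> /andP[/(hr n u v uv tI) fe /(hs n u v uv tI) ge].
rewrite [ltRHS](splitr e); apply: le_lt_trans (ltrD fe ge).
rewrite -big_split/=; apply: ler_sum => i _.
by rewrite opprD addrACA ler_normD.
Qed.

Lemma abs_continuousZ c d k f : abs_continuous c d f ->
  abs_continuous c d (fun t => k * f t).
Proof.
move=> acf e e0; have k0 : 0 < `|k| + 1 by rewrite ltr_wpDl.
have [r r0 hr] := acf _ (divr_gt0 e0 k0).
exists r => // n u v uv tI /(hr n u v uv tI); rewrite ltr_pdivlMr//.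
apply: le_lt_trans; rewrite mulr_suml; apply: ler_sum => i _.
by rewrite -mulrBr normrM mulrC ler_wpM2l// lerDl.
Qed.

Lemma lipschitz_abs_continuous c d K f :
  (forall u v, c <= u -> u <= v -> v <= d -> `|f v - f u| <= K * (v - u)) ->
  abs_continuous c d f.
Proof.
move=> fK e e0; have k0 : 0 < `|K| + 1 by rewrite ltr_wpDl.
exists (e / (`|K| + 1)); first by rewrite divr_gt0.
move=> n u v uv _; rewrite ltr_pdivlMr//; apply: le_lt_trans.
rewrite mulr_suml; apply: ler_sum => i _; have [cu ui vd] := uv i.
apply: le_trans (fK _ _ cu ui vd) _; rewrite mulrC ler_wpM2l ?subr_ge0//.
by rewrite (le_trans (ler_norm _))// lerDl.
Qed.

Lemma abs_continuous_linear c d k : abs_continuous c d (fun t => k * t).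
Proof.
apply: (@lipschitz_abs_continuous _ _ `|k|) => u v _ uv _.
by rewrite -mulrBr normrM (ger0_norm (_ : 0 <= v - u)) ?subr_ge0.
Qed.

Lemma is_derive_expRM (k t : R) :
  is_derive t 1 (fun t => expR (k * t)) (k * expR (k * t)).
Proof.
have h : is_derive t 1 (fun t => k * t) k.
  have := @is_deriveZ R R R id k t 1 1 _.
  by rewrite /GRing.scale/= mulr1; apply; exact: is_derive_id.
have := @is_derive1_comp R expR (fun t => k * t) t _ _ (is_derive_expR _) h.
by rewrite mulrC.
Qed.

Lemma abs_continuous_expRM c d k : abs_continuous c d (fun t => expR (k * t)).
Proof.
(* [K] bounds the derivative on the segment, whatever the sign of [k]. *)
pose K := `|k| * expR (`|k| * (`|c| + `|d|)).
apply: (@lipschitz_abs_continuous _ _ K) => u v cu uv vd.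
have [|s] := @MVT_segment R (fun t => expR (k * t)) (fun t => k * expR (k * t))
    u v uv (fun x _ => is_derive_expRM k x).
  apply: derivable_within_continuous => x _.
  by have [] := is_derive_expRM k x.
rewrite in_itv/= => /andP[us sv] ->.
rewrite normrM (ger0_norm (_ : 0 <= v - u)) ?subr_ge0//.
rewrite ler_wpM2r ?subr_ge0// normrM ler_wpM2l// ger0_norm ?expR_ge0//.
rewrite ler_expR (le_trans (ler_norm _))// normrM ler_wpM2l//.
rewrite ler_norml; apply/andP; split.
  have := ler_norm (- c); have := normr_ge0 d; rewrite normrN; lra.
by have := ler_norm d; have := normr_ge0 c; lra.
Qed.

Lemma abs_continuous_within c d f : abs_continuous c d f ->
  {within `[c, d], continuous f}.
Proof.
move=> acf; apply/subspace_continuousP => x.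
rewrite /= in_itv/= => /andP[cx xd].
apply/cvgrPdist_lt => e e0; have [r r0 hr] := acf e e0.
rewrite near_withinE; apply/nbhs_ballP; exists r => //= y.
rewrite /ball/= => xyr; rewrite in_itv/= => /andP[cy yd].
wlog yx : x y cx xd cy yd xyr / y <= x.
  move=> wl; have [/wl|/ltW/wl] := leP y x; first exact.
  by rewrite distrC [in X in _ -> X]distrC; apply.
have := hr 1%N (fun=> y) (fun=> x); rewrite !big_ord1; apply => //.
  by move=> i j _ _ _; rewrite !ord1.
by apply: le_lt_trans xyr; exact: ler_norm.
Qed.

Lemma within_continuousM_expR c d k f : {within `[c, d], continuous f} ->
  {within `[c, d], continuous (fun t => f t * expR (k * t))}.
Proof.
move=> /subspace_continuousP cf; apply/subspace_continuousP => x cxd.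
apply: cvgM; first exact: cf.
have /subspace_continuousP :=
  abs_continuous_within (@abs_continuous_expRM c d k).
exact.
Qed.

(** The mean value inequality in the form in which all derivative bounds are
    used: a majorant of the derivative is given by its primitive [g]. *)
Lemma abs_continuous_dist_le c d f g : c <= d ->
  abs_continuous c d f -> abs_continuous c d g ->
  (\forall t \ae @lebesgue_measure R, c <= t <= d ->
     exists df dg : R, [/\ is_derive t 1 f df, is_derive t 1 g dg &
       `|df| <= dg]) ->
  `|f d - f c| <= g d - g c.
Proof.
move=> cd acf acg dfg.
have main (s : R) : `|s| = 1 -> s * f d - s * f c <= g d - g c.
  move=> s1; suff : g c + - s * f c <= g d + - s * f d by rewrite !mulNr; lra.
  apply: (@abs_continuous_nondecreasing _ _ _ (fun t => g t + - s * f t)) => //.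
    by apply: abs_continuousD => //; exact: abs_continuousZ.
  apply: ae_mono dfg => t h /h[df [dg [dft dgt dfdg]]].
  exists (dg + - s * df).
    have h1 := @is_deriveZ R R R f (- s) t 1 df dft.
    exact: (is_deriveD dgt h1).
  have : s * df <= dg.
    by apply: le_trans dfdg; rewrite (le_trans (ler_norm _))// normrM s1 mul1r.
  by rewrite mulNr; lra.
have := main 1; rewrite normr1 !mul1r => /(_ erefl) h1.
have := main (-1); rewrite normrN1 => /(_ erefl) h2.
by rewrite ler_norml; apply/andP; split; lra.
Qed.

End absolute_continuity.

(** * Scalar delay equations whose coefficient times delay is small *)

(** A supersolution of [z' = - p * z(k)] stays nonnegative when
    [p * expR (lam * (t - k)) <= lam], a condition that some [lam] satisfies as
    soon as coefficient times delay is at most [1 / e].  The reason is that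
    [z * expR (lam * t)] is nondecreasing: at a point [s] where it is maximal,
    with value [C], the delayed values of [z] are at most those of
    [C * expR (- lam * t)], so that [z - C * expR (- lam * t)] has a nonnegative
    derivative from [s] on, starting from 0. *)
Lemma delay_supersolution_ge0 (R : realType) (c s1 T lam : R) (p k z : R -> R) :
  s1 <= T -> abs_continuous s1 T z -> 0 <= z s1 ->
  (forall s, c <= s <= s1 -> z s * expR (lam * s) <= z s1 * expR (lam * s1)) ->
  (\forall t \ae @lebesgue_measure R, s1 <= t <= T ->
     [/\ c <= k t <= t, 0 <= p t, p t * expR (lam * (t - k t)) <= lam &
       exists2 dz : R, is_derive t 1 z dz & 0 <= dz + p t * z (k t)]) ->
  0 <= z T.
Proof.
move=> sT acz z0 hist zae.
have [s] := EVT_max sT (@within_continuousM_expR _ _ _ lam _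
  (abs_continuous_within acz)).
rewrite in_itv/= => /andP[s1s ssT] smax.
pose C := z s * expR (lam * s).
have s1C : z s1 * expR (lam * s1) <= C by apply: smax; rewrite in_itv/= lexx.
have C0 : 0 <= C by rewrite (le_trans _ s1C)// mulr_ge0 ?expR_ge0.
have leC u : c <= u <= T -> z u * expR (lam * u) <= C.
  move=> /andP[cu uT]; have [us|/ltW su] := leP u s1.
    by apply: le_trans s1C; apply: hist; rewrite cu.
  by apply: smax; rewrite in_itv/= su.
have zE u : z u = z u * expR (lam * u) * expR (- lam * u).
  by rewrite -mulrA -expRD mulNr subrr expR0 mulr1.
suff : z s + - C * expR (- lam * s) <= z T + - C * expR (- lam * T).
  have zsC : z s = C * expR (- lam * s) by exact: zE.
  by rewrite zsC; have := mulr_ge0 C0 (expR_ge0 (- lam * T)); lra.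
apply: (@abs_continuous_nondecreasing _ _ _
    (fun t => z t + - C * expR (- lam * t))) => //.
  apply: abs_continuousD; first exact: abs_continuousS acz.
  by apply: abs_continuousZ; exact: abs_continuous_expRM.
apply: ae_mono zae => t h /andP[st tT].
have /h : s1 <= t <= T by rewrite (le_trans s1s st).
move=> [/andP[ck kt] p0 plam [dz dzt dz0]].
exists (dz + - C * (- lam * expR (- lam * t))).
  have h1 := @is_deriveZ R R R _ (- C) t 1 _ (is_derive_expRM (- lam) t).
  exact: (is_deriveD dzt h1).
have zk : p t * z (k t) <= C * (lam * expR (- lam * t)).
  rewrite zE; have := leC (k t); rewrite ck (le_trans kt tT) => /(_ isT) kC.
  apply: (@le_trans _ _ (p t * (C * expR (- lam * k t)))).
    by rewrite ler_wpM2l// ler_wpM2r ?expR_ge0.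
  have -> : - lam * k t = lam * (t - k t) + - lam * t by ring.
  rewrite expRD mulrCA ler_wpM2l// mulrA ler_wpM2r ?expR_ge0//.
by move: zk dz0; lra.
Qed.

(** The history condition of [delay_supersolution_ge0] for a function
    [a * expR (gam * r) - y] at distance [r] before the initial time.  As [gam]
    is at most [lam / 2], the exponential [expR (lam * r)] outgrows
    [expR (gam * r)] linearly in [r], and a large [a] turns this into a margin
    for the Lipschitz variation of [y]. *)
Lemma history_le (R : realType) (lam gam r tau a y ys L Y : R) :
  0 < lam -> 2 * gam <= lam -> 0 <= r -> r <= tau ->
  0 <= L -> `|y| <= Y -> `|ys - y| <= L * r ->
  2 * L / lam + Y * (expR (lam * tau / 2) + 1) <= a ->
  a * expR (gam * r) - ys <= (a - y) * expR (lam * r).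
Proof.
move=> lam0 gl r0 rt L0 yY yL aL.
have Y0 : 0 <= Y by exact: le_trans yY.
(* The right-hand side exceeds the left-hand side by at least [q - 1] times a
   quantity that the lower bound of [a] makes nonnegative. *)
pose q := expR (lam * r / 2); pose Q := expR (lam * tau / 2).
have qQ : q <= Q.
  by rewrite ler_expR ler_wpM2r ?invr_ge0// ler_wpM2l// ltW.
have qr : 1 + lam * r / 2 <= q by exact: expR_ge1Dx.
have q1 : 1 <= q.
  by apply: le_trans qr; rewrite lerDl divr_ge0// mulr_ge0// ltW.
have -> : expR (lam * r) = q * q by rewrite -expRD; congr expR; field.
have gq : expR (gam * r) <= q.
  rewrite ler_expR (_ : lam * r / 2 = lam / 2 * r); last by field.
  by rewrite ler_wpM2r// ler_pdivlMr// mulrC.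
rewrite -/Q in aL; clearbody Q.
have {qr} : lam * r / 2 <= q - 1 by lra.
move: gq; set g := expR (gam * r) => gq; clearbody g q.
pose u := 2 * L / lam; rewrite -/u in aL => qr.
have u0 : 0 <= u by rewrite divr_ge0 ?mulr_ge0// ltW.
have Lr : L * r <= u * (q - 1).
  have -> : L * r = u * (lam * r / 2).
    by rewrite /u; field; rewrite gt_eqF.
  by rewrite ler_wpM2l.
clearbody u.
have Q0 : 0 <= Y * (Q + 1) by rewrite mulr_ge0//; lra.
have a0 : 0 <= a by lra.
have e1 : a * g <= a * q by rewrite ler_wpM2l.
have e2 : - ys <= - y + u * (q - 1).
  by have := ler_norm (y - ys); rewrite distrC; lra.
have e3 : y * (q + 1) <= Y * (Q + 1).
  apply: (@le_trans _ _ (Y * (q + 1))).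
    by rewrite ler_wpM2r ?(le_trans (ler_norm _) yY)//; lra.
  by rewrite ler_wpM2l//; lra.
have aq : a <= a * q by rewrite ler_peMr.
have e4 : 0 <= (q - 1) * (a * q - u - y * (q + 1)).
  by rewrite mulr_ge0//; lra.
by move: e1 e2 e4; clear; nra.
Qed.

(** The function [A * expR (- gam * t)] minus or plus [y] is a supersolution:
    [p0 * F <= A * (p0 - gam)] says that the decay rate [gam] costs no more than
    what [A] exceeds the forcing [F] by.  For small [gam], [A] is close to [F]
    up to the contribution of the history. *)
Lemma delay_equation_decay (R : realType) (c s1 T lam gam p0 F A L Y tau : R)
    (p k y f : R -> R) :
  s1 <= T -> s1 <= c + tau -> abs_continuous s1 T y ->
  0 < lam -> 0 <= gam -> 2 * gam <= lam -> 0 < p0 -> 0 <= L ->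
  `|y s1| <= Y ->
  (forall s, c <= s <= s1 -> `|y s - y s1| <= L * (s1 - s)) ->
  (\forall t \ae @lebesgue_measure R, s1 <= t <= T ->
     [/\ c <= k t <= t, p0 <= p t, p t * expR (lam * (t - k t)) <= lam,
       `|f t| <= F * expR (- gam * t) &
       is_derive t 1 y (- p t * (y (k t) - f t))]) ->
  p0 * F <= A * (p0 - gam) ->
  2 * L / lam + Y * (expR (lam * tau / 2) + 1) <= A * expR (- gam * s1) ->
  `|y T| <= A * expR (- gam * T).
Proof.
move=> sT sc acy lam0 gam0 gl p00 L0 yY hist yae FA LA.
have Y0 : 0 <= Y by exact: le_trans yY.
have L1 : 0 <= 2 * L / lam by rewrite divr_ge0 ?mulr_ge0// ltW.
have aY : Y <= A * expR (- gam * s1).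
  apply: le_trans LA; have := expR_ge0 (lam * tau / 2).
  set Q := expR _ => Q0; have : 0 <= Y * Q by exact: mulr_ge0.
  by move: L1; lra.
have A0 : 0 <= A.
  by move: (le_trans Y0 aY); rewrite pmulr_lge0 ?expR_gt0.
have main (e : R) : `|e| = 1 -> 0 <= A * expR (- gam * T) + - e * y T.
  move=> e1.
  have ele u : e * u <= `|u|.
    by rewrite (le_trans (ler_norm _))// normrM e1 mul1r.
  pose z t := A * expR (- gam * t) + - e * y t.
  apply: (@delay_supersolution_ge0 _ c s1 T lam p k z) => //.
  - apply: abs_continuousD; apply: abs_continuousZ => //.
    exact: abs_continuous_expRM.
  - rewrite /z; have := ele (y s1); move: aY yY; lra.
  - move=> s /andP[cs ss1].
    have := @history_le _ lam gam (s1 - s) tau (A * expR (- gam * s1))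
      (e * y s1) (e * y s) L Y lam0 gl.
    rewrite subr_ge0 -mulrBr !normrM e1 !mul1r.
    move=> /(_ ss1); have st : s1 - s <= tau by lra.
    move=> /(_ st L0 yY); have cs1 : c <= s <= s1 by rewrite cs.
    move=> /(_ (hist _ cs1) LA); rewrite /z !mulNr -mulrA -expRD.
    have -> : - (gam * s1) + gam * (s1 - s) = - (gam * s) by ring.
    rewrite -(ler_pM2r (expR_gt0 (lam * s))) -[X in _ <= X -> _]mulrA -expRD.
    by have -> : lam * (s1 - s) + lam * s = lam * s1 by ring.
  - apply: ae_mono yae => t h /h[ck p0p plam ft dy].
    split=> //; first by apply: le_trans p0p; exact: ltW.
    exists (A * (- gam * expR (- gam * t)) + - e * (- p t * (y (k t) - f t))).
      have h1 := @is_deriveZ R R R _ A t 1 _ (is_derive_expRM (- gam) t).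
      have h2 := @is_deriveZ R R R _ (- e) t 1 _ dy.
      exact: (is_deriveD h1 h2).
    rewrite /z; have := ele (f t); set w := expR (- gam * t) in ft *.
    have wk : w <= expR (- gam * k t).
      by rewrite ler_expR !mulNr lerN2 ler_wpM2l//; case/andP: ck.
    move=> eft.
    have p1 : 0 <= p t by apply: le_trans p0p; exact: ltW.
    have pf : p t * (e * f t) <= p t * (F * w).
      by rewrite ler_wpM2l// (le_trans eft).
    have pA : p t * (A * w) <= p t * (A * expR (- gam * k t)).
      by rewrite ler_wpM2l// ler_wpM2l.
    have AF : F <= A.
      rewrite -(ler_pM2l p00) (le_trans FA)// mulrBr mulrC lerBlDr lerDl.
      exact: mulr_ge0.
    have g2 : gam * A <= p t * (A - F).
      apply: (@le_trans _ _ (p0 * (A - F))); first by move: FA; lra.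
      by rewrite ler_wpM2r ?subr_ge0.
    have g3 : gam * A * w <= p t * (A - F) * w by rewrite ler_wpM2r ?expR_ge0.
    move: pf pA g3; lra.
have h1 := main 1 (normr1 _); have h2 := main (-1) (normrN1 _).
by rewrite ler_norml; apply/andP; split; lra.
Qed.

(** * From [y] to [x]: a contraction almost everywhere *)

Lemma ae_comp_delay (R : realType) (h : R -> R) (P : R -> Prop) :
  null_preimages h -> (\forall t \ae @lebesgue_measure R, P t) ->
  \forall t \ae @lebesgue_measure R, 0 <= t -> P (h t).
Proof.
move=> hN /hN; apply: negligibleS => t /= /not_implyP[t0 nP].
by split=> //; rewrite /= in_itv/= t0.
Qed.

(** [L] is the fixed point of the improvement [S |-> L + kap * (S - L)]; its
    iterates are countably many, so that the bounds hold outside one null set,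
    where they converge to [L]. *)
Lemma ae_le_contraction (R : realType) (D : R -> Prop) (u v : R -> R)
    (L kap S0 : R) :
  0 <= kap < 1 -> (forall t, 0 <= v t) ->
  (\forall t \ae @lebesgue_measure R, D t -> u t <= S0 * v t) ->
  (forall S, L <= S ->
    (\forall t \ae @lebesgue_measure R, D t -> u t <= S * v t) ->
    \forall t \ae @lebesgue_measure R,
      D t -> u t <= (L + kap * (S - L)) * v t) ->
  \forall t \ae @lebesgue_measure R, D t -> u t <= L * v t.
Proof.
move=> /andP[k0 k1] v0 h0 hS.
pose E := Num.max (S0 - L) 0.
have E0 : 0 <= E by rewrite le_max lexx orbT.
have step n : \forall t \ae @lebesgue_measure R,
    D t -> u t <= (L + E * kap ^+ n) * v t.
  elim: n => [|n ih].
    apply: ae_mono h0 => t h /h /le_trans; apply; rewrite ler_wpM2r//.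
    by rewrite expr0 mulr1 -lerBlDl le_max lexx.
  have := hS (L + E * kap ^+ n) _ ih; rewrite lerDl mulr_ge0 ?exprn_ge0//.
  by move=> /(_ isT); rewrite addrAC subrr add0r exprS mulrCA.
apply: ae_mono (ae_foralln step) => t h Dt.
have cv : ((fun n => (L + E * kap ^+ n) * v t) @ \oo --> (L + 0) * v t)%classic.
  apply: cvgMl; apply: cvgD; first exact: cvg_cst.
  by apply: cvg_geometric; rewrite ger0_norm.
rewrite -[L]addr0 -(cvg_lim _ cv)//; apply: limr_ge.
  by apply/cvg_ex; eexists; exact: cv.
by apply: nearW => n; exact: h.
Qed.

(** The hypotheses are those of the theorem on the half-line [t >= sigma], with
    essential suprema replaced by the bounds [alpha] and [B], together with what
    is known of a solution [x]. *)
Section solution.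
Context {R : realType} (a b g h x : R -> R) (sigma Phi alpha B delta tau : R).
Let y t := x t - a t * x (g t).
Hypotheses (sigma0 : 0 <= sigma) (delta0 : 0 < delta) (tau0 : 0 < tau)
  (B0 : 0 < B) (alpha01 : 0 <= alpha < 1)
  (gN : null_preimages g) (hN : null_preimages h)
  (g_le : forall t, 0 <= t -> g t <= t)
  (h_le : \forall t \ae @lebesgue_measure R, 0 <= t -> h t <= t)
  (g_delay : \forall t \ae @lebesgue_measure R, sigma <= t -> t - g t <= delta)
  (h_delay : \forall t \ae @lebesgue_measure R, sigma <= t -> t - h t <= tau)
  (a_le : forall t, sigma <= t -> `|a t| <= alpha)
  (b_le : \forall t \ae @lebesgue_measure R, sigma <= t -> `|b t| <= B)
  (x_init : forall t, t <= sigma -> `|x t| <= Phi)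
  (x_bdd : forall T, exists S0 : R,
     \forall t \ae @lebesgue_measure R, sigma <= t <= T -> `|x t| <= S0)
  (y_ac : locally_abs_continuous sigma y)
  (y_eq : \forall t \ae @lebesgue_measure R, sigma <= t ->
     is_derive t 1 y (- (b t * x (h t)))).

(* The weight has a sign left open: it grows on the first interval, where only
   a crude bound is needed, and decays afterwards. *)
Let w (k t : R) := expR (k * (t - sigma)).

Let Phi0 : 0 <= Phi.
Proof. exact: le_trans (x_init (lexx sigma)). Qed.

Let w_sigma k : w k sigma = 1.
Proof. by rewrite /w subrr mulr0 expR0. Qed.

Let w_ge0 k t : 0 <= w k t. Proof. exact: expR_ge0. Qed.

Lemma delay_weight k rho r s t :
  (forall z, 0 <= z <= r -> expR (- k * z) <= rho) ->
  s <= t -> t - s <= r -> w k s <= rho * w k t.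
Proof.
move=> hr st tsr; rewrite /w.
have -> : k * (s - sigma) = - k * (t - s) + k * (t - sigma) by ring.
by rewrite expRD ler_wpM2r ?expR_ge0// hr// subr_ge0 st.
Qed.

(** A delay of at most [r] costs a factor [rho] in a weighted bound.  Before
    [sigma] the bound [Phi] takes over, as the weight is 1 at [sigma]. *)
Lemma delayed_bound k rho r (d : R -> R) S T :
  null_preimages d ->
  (\forall t \ae @lebesgue_measure R, 0 <= t -> d t <= t) ->
  (\forall t \ae @lebesgue_measure R, sigma <= t -> t - d t <= r) ->
  (forall z, 0 <= z <= r -> expR (- k * z) <= rho) ->
  Phi <= S ->
  (\forall t \ae @lebesgue_measure R, sigma <= t <= T -> `|x t| <= S * w k t) ->
  \forall t \ae @lebesgue_measure R, sigma <= t <= T ->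
    `|x (d t)| <= S * (rho * w k t).
Proof.
move=> dN dle ddel hr PS xS.
apply: ae_mono (ae_and (ae_and dle ddel) (ae_comp_delay dN xS)) => t.
move=> [[h1 h2] h3] /andP[st tT].
have t0 : 0 <= t by exact: le_trans st.
have {}h1 := h1 t0; have {}h2 := h2 st; have {}h3 := h3 t0.
have S0 : 0 <= S by exact: le_trans PS.
have [ds|sd] := leP (d t) sigma.
  apply: le_trans (x_init ds) _; apply: le_trans PS _.
  rewrite ler_peMr// -(w_sigma k) (delay_weight hr)//; lra.
apply: le_trans (h3 _) _; first by rewrite (ltW sd)/= (le_trans h1).
by rewrite ler_wpM2l// (delay_weight hr).
Qed.

(** A bound [S * w] of [x] gives [|x| <= |y| + alpha * |x(g)| <= (Y + alpha *
    rho * S) * w], a contraction in [S].  Some bound to start from exists since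
    [x] is locally essentially bounded and [w] is bounded below on segments. *)
Lemma neutral_bound k rho Y T :
  (forall z, 0 <= z <= delta -> expR (- k * z) <= rho) ->
  alpha * rho < 1 ->
  (forall t, sigma <= t <= T -> `|y t| <= Y * w k t) ->
  0 <= Y ->
  \forall t \ae @lebesgue_measure R, sigma <= t <= T ->
    `|x t| <= (Phi + Y / (1 - alpha * rho)) * w k t.
Proof.
move=> hr ar1 yY Y0; have /andP[al0 al1] := alpha01.
have rho0 : 0 <= rho.
  by apply: le_trans (expR_ge0 (- k * 0)) (hr _ _); rewrite lexx ltW.
have ar0 : 0 <= alpha * rho by rewrite mulr_ge0.
have d0 : 0 < 1 - alpha * rho by rewrite subr_gt0.
have [S0 xS0] := x_bdd T.
pose W := expR (- `|k| * (`|T| + `|sigma|)).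
have wW t : sigma <= t <= T -> W <= w k t.
  move=> /andP[st tT]; rewrite /W /w ler_expR mulNr.
  suff : `|k * (t - sigma)| <= `|k| * (`|T| + `|sigma|).
    by rewrite ler_norml => /andP[].
  rewrite normrM ler_wpM2l// ger0_norm ?subr_ge0//.
  by have := ler_norm T; have := ler_norm (- sigma); rewrite normrN; lra.
apply: (@ae_le_contraction _ _ _ (w k) _ (alpha * rho) (`|S0| / W)).
- by rewrite ar0.
- exact: w_ge0.
- apply: ae_mono xS0 => t hx /[dup] /hx xS st.
  apply: le_trans xS _; rewrite (le_trans (ler_norm _))//.
  rewrite -mulrA ler_peMr// mulrC ler_pdivlMr ?expR_gt0// mul1r.
  exact: wW.
- move=> S LS xS.
  have PS : Phi <= S.
    by apply: le_trans LS; rewrite lerDl divr_ge0// ltW.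
  have gle : \forall t \ae @lebesgue_measure R, 0 <= t -> g t <= t.
    exact: aeW.
  apply: ae_mono (delayed_bound gN gle g_delay hr PS xS) => t hx st.
  have {hx} := hx st; have := yY t st.
  have := a_le (proj1 (andP st)); rewrite /y.
  set X := x (g t) => aal hy hX.
  have aX : `|a t * X| <= alpha * (S * (rho * w k t)).
    by rewrite normrM ler_pM.
  have : `|x t| <= `|x t - a t * X| + `|a t * X|.
    by rewrite -{1}(subrK (a t * X) (x t)) ler_normD.
  move=> /le_trans; apply; apply: le_trans (lerD hy aX) _.
  rewrite (_ : alpha * (S * _) = alpha * rho * S * w k t); last by ring.
  rewrite -mulrDl ler_wpM2r// mulrBr mulrDr.
  set q := alpha * rho in d0 *.
  have e1 : Y = Y / (1 - q) * (1 - q) by rewrite divfK// gt_eqF.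
  have e2 : 0 <= Phi * (1 - q) by rewrite mulr_ge0// ltW.
  by move: e1 e2; set Z := Y / (1 - q); lra.
Qed.

Let y_cont T : {within `[sigma, T], continuous y}.
Proof. exact: abs_continuous_within (y_ac T). Qed.

(** The least [Y] with [|y| <= Y * w] on a segment is attained at a point [s],
    so that improving [Y] amounts to estimating [y] at [s] only. *)
Lemma weighted_max k T : sigma <= T ->
  exists s, [/\ sigma <= s, s <= T &
    forall t, sigma <= t <= T -> `|y t| <= `|y s| / w k s * w k t].
Proof.
move=> sT; have cy : {within `[sigma, T], continuous (fun t => `|y t|)}.
  apply/subspace_continuousP => z zI; apply: cvg_norm.
  by have /subspace_continuousP := y_cont (T := T); exact.
have [s] := EVT_max sT (@within_continuousM_expR _ _ _ (- k) _ cy).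
rewrite in_itv/= => /andP[ss sT'] smax; exists s; split=> // t tI.
have := smax t; rewrite in_itv/= => /(_ tI).
have wE u : expR (- k * u) = expR (- k * sigma) / w k u.
  by rewrite /w -expRN -expRD; congr expR; ring.
rewrite (wE t) (wE s) mulrCA [leRHS]mulrCA ler_pM2l ?expR_gt0//.
by rewrite ler_pdivrMr ?expR_gt0.
Qed.

(** * The first interval after the initial point *)

(* The growth rate [mu] makes the integral of [B * w / (1 - alpha)] at most
   [w / 2], so that the loop from [y] to [x] and back closes. *)
Let mu := 2 * B / (1 - alpha).
Let L := B * (1 + 5 / (1 - alpha)) * expR (mu * tau) * Phi.
Let Y0 := 5 * expR (mu * tau) * Phi.

(** On the first interval of length [tau] the delay [h] may reach before
    [sigma], where [y] is not controlled by the equation.  Growth is bounded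
    there by a Gronwall argument, which also provides the Lipschitz constant
    that [delay_equation_decay] requires of the history. *)
Lemma initial_interval_bound :
  (forall t, sigma <= t <= sigma + tau -> `|y t| <= Y0) /\
  (forall t, sigma <= t <= sigma + tau ->
     `|y t - y (sigma + tau)| <= L * (sigma + tau - t)).
Proof.
have /andP[al0 al1] := alpha01.
have d0 : 0 < 1 - alpha by rewrite subr_gt0.
have mu0 : 0 < mu by rewrite /mu divr_gt0// mulr_gt0.
have B0' := ltW B0; have mu0' := ltW mu0; have d0' := ltW d0.
pose T := sigma + tau; have sT : sigma <= T by rewrite lerDl ltW.
have [s [ss sT' smax]] := weighted_max mu sT.
set Y := `|y s| / w mu s in smax.
have Yge0 : 0 <= Y by rewrite divr_ge0.
have hr r z : 0 <= z <= r -> expR (- mu * z) <= 1.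
  move=> /andP[z0 _]; rewrite -expR0 ler_expR mulNr oppr_le0.
  by rewrite mulr_ge0// ltW.
have := neutral_bound (hr delta) _ smax Yge0; rewrite mulr1 => /(_ al1).
set S := Phi + Y / (1 - alpha) => xS.
have PS : Phi <= S by rewrite /S lerDl divr_ge0// ltW.
have S0 : 0 <= S by exact: le_trans PS.
have dyS : \forall t \ae @lebesgue_measure R, sigma <= t <= T ->
    exists2 dy : R, is_derive t 1 y dy & `|dy| <= B * (S * w mu t).
  have xh := delayed_bound hN h_le h_delay (hr tau) PS xS.
  apply: ae_mono (ae_and (ae_and y_eq b_le) xh) => t [[h1 h2] h3] st.
  have st' := proj1 (andP st).
  exists (- (b t * x (h t))); first exact: h1.
  rewrite normrN normrM; apply: ler_pM => //; first exact: h2.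
  by have := h3 st; rewrite mul1r.
have ys : `|y sigma| <= 2 * Phi.
  rewrite /y (le_trans (ler_normB _ _))// normrM.
  have h1 := x_init (lexx sigma).
  have h2 := x_init (g_le sigma0).
  have h3 : `|a sigma| * `|x (g sigma)| <= 1 * Phi.
    by apply: ler_pM => //; rewrite (le_trans (a_le (lexx _)))// ltW.
  by move: h1 h3; lra.
have w1 : 1 <= w mu s.
  by rewrite -expR0 ler_expR mulr_ge0 ?subr_ge0// ltW.
have Ys : `|y s - y sigma| <= B * S / mu * w mu s.
  have := @abs_continuous_dist_le R sigma s y
    (fun t => B * S / mu * expR (- mu * sigma) * expR (mu * t)) ss.
  have wE t : B * S / mu * expR (- mu * sigma) * expR (mu * t) =
      B * S / mu * w mu t.
    by rewrite -mulrA -expRD /w; congr (_ * expR _); ring.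
  rewrite /= !wE => /(_ _ _ _)/le_trans; apply.
  - exact: abs_continuousS (y_ac T).
  - by apply: abs_continuousZ; exact: abs_continuous_expRM.
  - apply: ae_mono dyS => t ht /andP[st ts].
    have [|dy dyt dyB] := ht; first by rewrite st (le_trans ts).
    exists dy, (B * S / mu * expR (- mu * sigma) * (mu * expR (mu * t))).
    split => //.
      exact: (@is_deriveZ R R R _ (B * S / mu * expR (- mu * sigma))
                t 1 _ (is_derive_expRM mu t)).
    apply: le_trans dyB _; rewrite [leRHS]mulrCA wE.
    rewrite (_ : mu * _ = B * (S * w mu t))//.
    by field; rewrite gt_eqF.
  - rewrite gerBl mulr_ge0 ?w_ge0//.
    by apply: divr_ge0 => //; exact: mulr_ge0.
have Y5 : Y <= 5 * Phi.
  have e1 : Y * w mu s <= (2 * Phi + B * S / mu) * w mu s.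
    rewrite mulrDl /Y divfK ?gt_eqF ?expR_gt0//.
    apply: le_trans (_ : `|y sigma| + `|y s - y sigma| <= _).
      by rewrite -{1}(subrK (y sigma) (y s)) addrC ler_normD.
    apply: lerD => //; apply: le_trans ys _.
    by rewrite ler_peMr// mulr_ge0.
  have e2 : Y <= 2 * Phi + B * S / mu.
    by move: e1; rewrite ler_pM2r// expR_gt0.
  have e3 : B * S / mu = (1 - alpha) * Phi / 2 + Y / 2.
    by rewrite /S /mu; field; rewrite !gt_eqF.
  have e4 : (1 - alpha) * Phi <= 1 * Phi.
    by rewrite ler_wpM2r// lerBlDr lerDl.
  by move: e2 e3 e4; set Q := B * S / mu; set Q' := (1 - alpha) * Phi; lra.
have wT t : sigma <= t <= T -> w mu t <= expR (mu * tau).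
  move=> /andP[st tT]; rewrite ler_expR ler_wpM2l//.
  by rewrite lerBlDl.
have S5 : S <= (1 + 5 / (1 - alpha)) * Phi.
  rewrite /S mulrDl mul1r lerD2l [leRHS]mulrAC.
  by rewrite ler_wpM2r ?invr_ge0.
split => t tI.
  apply: le_trans (smax t tI) _; rewrite /Y0 [leRHS]mulrAC.
  by apply: ler_pM => //; exact: wT.
have /andP[st tT] := tI; rewrite distrC mulrBr.
apply: (@abs_continuous_dist_le R t T y (fun t => L * t)) => //.
- exact: abs_continuousS (y_ac T).
- exact: abs_continuous_linear.
- apply: ae_mono dyS => z hz /andP[tz zT].
  have zI : sigma <= z <= T by rewrite (le_trans st).
  have [dy dyz dyB] := hz zI; exists dy, L; split => //.
    have := @is_deriveZ R R R id L z 1 1 (is_derive_id _ _).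
    by rewrite /GRing.scale/= mulr1.
  apply: le_trans dyB _.
  rewrite (_ : L = B * ((1 + 5 / (1 - alpha)) * Phi * expR (mu * tau))).
    by rewrite ler_wpM2l//; apply: ler_pM => //; exact: wT.
  by rewrite /L; ring.
Qed.

(** * Decay: closing the loop *)

Section decay.
Context (k p : R -> R) (lam p0 N1 N2 gam : R).
(* [eta] dominates the factors lost to all delays: at most two delays by [h],
   or one by [h] and one by [g], are composed. *)
Let eta := expR (gam * (2 * (tau + delta))).
(* The gain of the loop from [Y] to itself. *)
Let kappa := p0 * eta * (N1 + N2 / (1 - alpha * eta)) / (p0 - gam).
Hypotheses (lam0 : 0 < lam) (p00 : 0 < p0) (N10 : 0 <= N1) (N20 : 0 <= N2)
  (gam0 : 0 < gam) (gam_lam : 2 * gam <= lam) (gam_p0 : gam < p0)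
  (alpha_eta : alpha * eta < 1) (kappa1 : kappa < 1)
  (kp : \forall t \ae @lebesgue_measure R, sigma + tau <= t ->
     [/\ sigma <= k t <= t, p0 <= p t & p t * expR (lam * (t - k t)) <= lam])
  (f_le : forall T Y S, Phi <= S -> 0 <= Y ->
     (forall t, sigma <= t <= T -> `|y t| <= Y * w (- gam) t) ->
     (\forall t \ae @lebesgue_measure R, sigma <= t <= T ->
        `|x t| <= S * w (- gam) t) ->
     \forall t \ae @lebesgue_measure R, sigma + tau <= t <= T ->
       `|y (k t) - b t / p t * x (h t)| <=
         eta * (N1 * Y + N2 * S) * w (- gam) t).

Let K0 := 5 * expR (mu * tau).
Let L0 := B * (1 + 5 / (1 - alpha)) * expR (mu * tau).
Let C0 := 2 * L0 / lam + K0 * (expR (lam * tau / 2) + 1).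
Let C1 := p0 * eta * N2 / (p0 - gam) + C0 * expR (gam * tau).

(** Let [Y] be the least weighted bound of [y], attained at [s].  If [s] lies in
    the first interval then [Y] is a multiple of [Phi]; otherwise
    [delay_equation_decay] on [sigma + tau, s] gives
    [Y <= kappa * Y + C1 * Phi].  The constant does not depend on [T]. *)
Lemma solution_decay T : sigma + tau <= T ->
  \forall t \ae @lebesgue_measure R, sigma <= t <= T ->
    `|x t| <= (1 + C1 / (1 - kappa) / (1 - alpha * eta)) * Phi * w (- gam) t.
Proof.
move=> sT; have /andP[al0 al1] := alpha01.
have d0 : 0 < 1 - alpha by rewrite subr_gt0.
have de0 : 0 < 1 - alpha * eta by rewrite subr_gt0.
have dk0 : 0 < 1 - kappa by rewrite subr_gt0.
have pg0 : 0 < p0 - gam by rewrite subr_gt0.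
have B0' := ltW B0; have lam0' := ltW lam0; have d0' := ltW d0.
have de0' := ltW de0; have dk0' := ltW dk0; have pg0' := ltW pg0.
have gam0' := ltW gam0; have tau0' := ltW tau0; have p00' := ltW p00.
pose s1 := sigma + tau; have ss1 : sigma <= s1 by rewrite lerDl ltW.
have [yY0 yL] := initial_interval_bound.
have [s [ss sT' smax]] := weighted_max (- gam) (le_trans ss1 sT).
set Y := `|y s| / w (- gam) s in smax.
have Yge0 : 0 <= Y by rewrite divr_ge0.
have hr z : 0 <= z <= delta -> expR (- - gam * z) <= eta.
  move=> /andP[z0 zd]; rewrite opprK ler_expR ler_wpM2l ?(ltW gam0)//.
  by move: (tau0) (delta0); lra.
have := neutral_bound hr alpha_eta smax Yge0.
set S := Phi + Y / (1 - alpha * eta) => xS.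
have PS : Phi <= S by rewrite /S lerDl divr_ge0// ltW.
have S0 : 0 <= S by exact: le_trans PS.
have K00 : 0 <= K0 by rewrite mulr_ge0 ?expR_ge0.
have L00 : 0 <= L0.
  by rewrite /L0 !mulr_ge0 ?expR_ge0 ?(ltW B0)// addr_ge0 ?divr_ge0// ltW.
have C00 : 0 <= 2 * L0 / lam by apply: divr_ge0 => //; exact: mulr_ge0.
have C0K : K0 <= C0.
  have : 0 <= K0 * expR (lam * tau / 2) by rewrite mulr_ge0 ?expR_ge0.
  by rewrite /C0 mulrDr mulr1; move: C00; lra.
have C0ge0 : 0 <= C0 by exact: le_trans C0K.
pose F := eta * (N1 * Y + N2 * S).
have F0 : 0 <= F by rewrite mulr_ge0 ?expR_ge0// addr_ge0// mulr_ge0.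
pose A := p0 * F / (p0 - gam) + C0 * expR (gam * tau) * Phi.
have A1 : 0 <= p0 * F / (p0 - gam) by apply: divr_ge0 => //; exact: mulr_ge0.
have egt : 1 <= expR (gam * tau).
  by rewrite -expR0 ler_expR mulr_ge0// ltW.
have A2 : 0 <= C0 * expR (gam * tau) * Phi by rewrite !mulr_ge0 ?expR_ge0.
have YA : Y <= A.
  rewrite ler_pdivrMr ?expR_gt0//.
  have [s_s1|s1_s] := leP s s1.
    apply: le_trans (yY0 s _) _; first by rewrite ss.
    apply: (@le_trans _ _ (C0 * expR (gam * tau) * Phi * w (- gam) s));
        last first.
      by rewrite ler_wpM2r// lerDr.
    rewrite /Y0 -/K0 [leRHS]mulrAC ler_wpM2r// -mulrA.
    apply: le_trans C0K _; rewrite ler_peMr// -expRD -expR0 ler_expR.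
    rewrite mulNr -mulrBr mulr_ge0 ?(ltW gam0)//.
    by move: s_s1; rewrite /s1; lra.
  have wE t : w (- gam) t = expR (gam * sigma) * expR (- gam * t).
    by rewrite /w -expRD; congr expR; ring.
  rewrite wE mulrA.
  apply: (@delay_equation_decay R sigma s1 s lam gam p0
    (F * expR (gam * sigma)) (A * expR (gam * sigma)) (L0 * Phi) (K0 * Phi) tau
    p k y (fun t => y (k t) - b t / p t * x (h t))) => //.
  - exact: ltW.
  - exact: abs_continuousS (y_ac s).
  - exact: mulr_ge0.
  - by apply: yY0; rewrite ss1 lexx.
  - apply: ae_mono (ae_and (ae_and y_eq kp) (f_le PS Yge0 smax xS)) => t.
    move=> [[h1 h2] h3] /andP[s1t ts].
    have [kt p0p plam] := h2 s1t.
    split => //.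
      by rewrite -[leRHS]mulrA -wE; apply: h3; rewrite s1t (le_trans ts).
    apply: is_derive_eq (h1 (le_trans ss1 s1t)) _.
    by field; rewrite gt_eqF// (lt_le_trans p00).
  - rewrite mulrA [leRHS]mulrAC ler_wpM2r ?expR_ge0// /A mulrDl divfK ?gt_eqF//.
    by rewrite lerDl mulr_ge0// ltW.
  - rewrite -[leRHS]mulrA -wE.
    apply: (@le_trans _ _ (C0 * expR (gam * tau) * Phi * w (- gam) s1));
        last first.
      by rewrite ler_wpM2r// lerDr.
    have -> : C0 * expR (gam * tau) * Phi * w (- gam) s1 = C0 * Phi.
      have ww : expR (gam * tau) * w (- gam) s1 = 1.
        by rewrite -expRD -expR0; congr expR; rewrite /s1; ring.
      by rewrite -[RHS]mulr1 -ww; ring.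
    rewrite (_ : C0 * Phi = 2 * (L0 * Phi) / lam +
      K0 * Phi * (expR (lam * tau / 2) + 1))//.
    by rewrite /C0; ring.
have AE : A = kappa * Y + C1 * Phi.
  by rewrite /A /F /S /kappa /C1; field; rewrite !gt_eqF.
have Yle : Y <= C1 / (1 - kappa) * Phi.
  rewrite mulrAC ler_pdivlMr//; move: YA; rewrite AE.
  by rewrite mulrBr mulr1 [Y * _]mulrC; lra.
apply: ae_mono xS => t hx /hx /le_trans; apply.
rewrite ler_wpM2r// /S [leRHS]mulrDl mul1r lerD2l [leRHS]mulrAC.
by rewrite ler_wpM2r ?invr_ge0.
Qed.

End decay.

(** * The forcing term under the two conditions *)

Section perturbation.
Context (gam S T : R).
Let eta := expR (gam * (2 * (tau + delta))).
Hypotheses (gam0 : 0 <= gam) (PS : Phi <= S)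
  (xS : \forall t \ae @lebesgue_measure R, sigma <= t <= T ->
     `|x t| <= S * w (- gam) t).

Let S0 : 0 <= S. Proof. exact: le_trans PS. Qed.

Let delay_factor r z : 0 <= z <= r -> expR (- - gam * z) <= expR (gam * r).
Proof. by move=> /andP[z0 zr]; rewrite opprK ler_expR ler_wpM2l. Qed.

Lemma neutral_term_bound :
  \forall t \ae @lebesgue_measure R, sigma + tau <= t <= T ->
    [/\ sigma <= h t <= t, w (- gam) (h t) <= expR (gam * tau) * w (- gam) t &
      `|a (h t) * x (g (h t))| <= alpha * S * eta * w (- gam) t].
Proof.
have gle : \forall t \ae @lebesgue_measure R, 0 <= t -> g t <= t by exact: aeW.
have xg := delayed_bound gN gle g_delay (@delay_factor delta) PS xS.
apply: ae_mono (ae_and (ae_and h_le h_delay) (ae_comp_delay hN xg)) => t.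
move=> [[h1 h2] h3] /andP[st tT].
have sg : sigma <= t by apply: le_trans st; rewrite lerDl ltW.
have t0 : 0 <= t by exact: le_trans sg.
have {}h1 := h1 t0; have {}h2 := h2 sg.
have sh : sigma <= h t by lra.
have wh := delay_weight (@delay_factor tau) h1 h2.
split=> //; first by rewrite sh.
have shT : sigma <= h t <= T by rewrite sh (le_trans h1).
have {}h3 := h3 t0 shT.
rewrite normrM -!mulrA; apply: ler_pM => //; first exact: a_le.
apply: le_trans h3 _; rewrite ler_wpM2l//.
apply: (@le_trans _ _ (expR (gam * delta) * (expR (gam * tau) * w (- gam) t))).
  by rewrite ler_wpM2l ?expR_ge0.
rewrite mulrA -expRD ler_wpM2r// ler_expR -mulrDr ler_wpM2l//.
by move: (tau0) (delta0); lra.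
Qed.

(** With [k = h] the forcing term is
    [- ((b - beta) / beta) * y(h) - (b / beta) * a(h) * x(g(h))]. *)
Lemma perturbation_small_coefficient (beta : R -> R) (N1 N2 Y : R) :
  (\forall t \ae @lebesgue_measure R, sigma <= t ->
     [/\ beta t != 0, `|(b t - beta t) / beta t| <= N1 &
       `|b t / beta t| <= N2]) ->
  0 <= Y -> (forall t, sigma <= t <= T -> `|y t| <= Y * w (- gam) t) ->
  \forall t \ae @lebesgue_measure R, sigma + tau <= t <= T ->
    `|y (h t) - b t / beta t * x (h t)| <=
      eta * (N1 * Y + N2 * alpha * S) * w (- gam) t.
Proof.
move=> bN Yge0 yY.
apply: ae_mono (ae_and bN neutral_term_bound) => t [h1 h2] tT.
have st : sigma <= t.
  by move: tT => /andP[+ _]; apply: le_trans; rewrite lerDl ltW.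
have [b0 bN1 bN2] := h1 st; have [/andP[sh ht] wh ax] := h2 tT.
rewrite (_ : y (h t) - _ = - ((b t - beta t) / beta t * y (h t)) -
    b t / beta t * (a (h t) * x (g (h t)))); last by rewrite /y; field.
apply: le_trans (ler_normB _ _) _.
rewrite normrN (normrM _ (y _)) (normrM _ (_ * _)).
have yh : `|y (h t)| <= Y * (eta * w (- gam) t).
  apply: le_trans (yY _ _) _.
    by rewrite sh (le_trans ht)//; case/andP: tT.
  rewrite ler_wpM2l// (le_trans wh)// ler_wpM2r// ler_expR ler_wpM2l//.
  by move: (tau0) (delta0); lra.
rewrite (_ : eta * _ * _ = N1 * (Y * (eta * w (- gam) t)) +
  N2 * (alpha * S * eta * w (- gam) t)); last by ring.
by apply: lerD; apply: ler_pM.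
Qed.

(** With [p = b] the forcing term is [y(k) - y(h) - a(h) * x(g(h))].  Between
    [h] and [k] the derivative of [y] is [- b * x(h)], which two delays by [h]
    separate from the time [t]; hence the factor 2 in [eta]. *)
Lemma perturbation_small_delay (r N : R) :
  0 <= r -> 0 <= N ->
  (\forall t \ae @lebesgue_measure R, sigma <= t ->
     b t != 0 /\ Num.max (t - h t - r) 0 <= N) ->
  \forall t \ae @lebesgue_measure R, sigma + tau <= t <= T ->
    `|y (Num.max (h t) (t - r)) - b t / b t * x (h t)| <=
      eta * ((B * N + alpha) * S) * w (- gam) t.
Proof.
move=> r0 N0 bN.
have xh := delayed_bound hN h_le h_delay (@delay_factor tau) PS xS.
apply: ae_mono (ae_and bN neutral_term_bound) => t [h1 h2] tT.
have st : sigma <= t.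
  by move: tT => /andP[+ _]; apply: le_trans; rewrite lerDl ltW.
have [b0 hN1] := h1 st; have [/andP[sh ht] wh ax] := h2 tT.
rewrite divff// mul1r; set k := Num.max (h t) (t - r).
have hk : h t <= k by rewrite le_max lexx.
have kt : k <= t by rewrite ge_max ht gerBl.
have kN : k - h t <= N.
  apply: le_trans hN1; rewrite /k maxEle maxEle; case: ifP => _; case: ifP; lra.
have yk : `|y k - y (h t)| <=
    B * (S * (expR (gam * tau) * w (- gam) (h t))) * N.
  set L' := B * _; apply: (@le_trans _ _ (L' * (k - h t))); last first.
    by rewrite ler_wpM2l// !mulr_ge0 ?expR_ge0// ltW.
  rewrite mulrBr.
  apply: (@abs_continuous_dist_le R (h t) k y (fun t => L' * t)) => //.
  - exact: abs_continuousS (y_ac k).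
  - exact: abs_continuous_linear.
  - apply: ae_mono (ae_and (ae_and y_eq b_le) xh) => z.
    move=> [[z1 z2] z3] /andP[hz zk].
    have sz : sigma <= z by exact: le_trans hz.
    exists (- (b z * x (h z))), L'; split; first exact: z1.
      have := @is_deriveZ R R R id L' z 1 1 (is_derive_id _ _).
      by rewrite /GRing.scale/= mulr1.
    rewrite normrN normrM; apply: ler_pM => //; first exact: z2.
    apply: le_trans (z3 _) _.
      by rewrite sz (le_trans zk)// (le_trans kt)//; case/andP: tT.
    rewrite ler_wpM2l// ler_wpM2l ?expR_ge0// /w ler_expR !mulNr lerN2.
    by rewrite ler_wpM2l// lerD2r.
rewrite (_ : y k - x (h t) = y k - y (h t) - a (h t) * x (g (h t))); last first.
  by rewrite /y; ring.
apply: le_trans (ler_normB _ _) _.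
rewrite (_ : eta * _ * _ = B * (S * (eta * w (- gam) t)) * N +
  alpha * S * eta * w (- gam) t); last by ring.
apply: lerD => //; apply: le_trans yk _.
rewrite ler_wpM2r// ler_wpM2l ?(ltW B0)// ler_wpM2l//.
apply: (@le_trans _ _ (expR (gam * tau) * (expR (gam * tau) * w (- gam) t))).
  by rewrite ler_wpM2l ?expR_ge0.
rewrite mulrA -expRD ler_wpM2r// ler_expR -mulrDr ler_wpM2l//.
by move: (tau0) (delta0); lra.
Qed.

End perturbation.

End solution.

(** * Essential norms and the choice of the rate *)

Section essential_norm.
Context {R : realType}.
Let mu := @lebesgue_measure R.
Implicit Types (D : set R) (u : R -> R).

Lemma lebesgue_measure_setT_gt0 : (0 < mu [set: R])%E.
Proof.
apply: (@lt_le_trans _ _ (mu `[0, 1]%classic)).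
  by rewrite /mu lebesgue_measure_itv/= lte_fin ltr01 sube0 lte_fin ltr01.
by apply: le_measure; rewrite ?inE.
Qed.

Lemma ess_norm_leP D u C : 0 <= C ->
  (ess_norm D u <= C%:E)%E <-> \forall t \ae mu, D t -> `|u t| <= C.
Proof.
move=> C0; split.
  move=> /ess_supP; apply: ae_mono => t; rewrite patchE => h Dt.
  by move: h; rewrite mem_set//= lee_fin.
move=> h; apply/ess_supP; apply: ae_mono h => t h; rewrite patchE.
by case: ifPn => [/set_mem/h|_]; rewrite lee_fin.
Qed.

Lemma ess_norm_ge0 D u : (0 <= ess_norm D u)%E.
Proof.
apply: ess_sup_gee; first exact: lebesgue_measure_setT_gt0.
by apply: aeW => t; rewrite patchE; case: ifP => _; rewrite lee_fin.
Qed.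

Lemma ess_norm_fin D u : (ess_norm D u < +oo)%E ->
  exists2 c : R, ess_norm D u = c%:E &
    0 <= c /\ \forall t \ae mu, D t -> `|u t| <= c.
Proof.
move=> uoo; have u0 := ess_norm_ge0 D u.
have uE : ess_norm D u = (fine (ess_norm D u))%:E.
  by rewrite fineK// ge0_fin_numE.
have c0 : 0 <= fine (ess_norm D u) by exact: fine_ge0.
exists (fine (ess_norm D u)) => //; split=> //.
by apply/ess_norm_leP => //; rewrite -uE.
Qed.

End essential_norm.

Lemma ae_ge_exists (R : realType) (t0 : R) (P : R -> Prop) :
  (\forall t \ae @lebesgue_measure R, t0 <= t -> P t) -> exists t, P t.
Proof.
move=> hP; apply: contrapT => nP.
have : (@lebesgue_measure R).-negligible `[t0, t0 + 1].
  apply: negligibleS hP => t /=; rewrite in_itv/= => /andP[t0t _] /(_ t0t) Pt.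
  by apply: nP; exists t.
move=> hn; have : (lebesgue_measure `[t0, (t0 + 1)%R]%classic = 0)%E.
  by apply: measure_negligible => //; exact: measurable_itv.
rewrite lebesgue_measure_itv/= lte_fin ltrDl ltr01.
by move=> /eqP; rewrite -EFinB addrAC subrr add0r eqe oner_eq0.
Qed.

(** The upper bounds hold strictly at [gam = 0] and involve continuous functions
    of [gam] only, so that they persist for small [gam > 0]. *)
Lemma small_rate_exists (R : realType) (alpha N1 N2 lam p0 r : R) :
  alpha < 1 -> 0 < lam -> 0 < p0 -> N1 + N2 / (1 - alpha) < 1 ->
  exists gam : R, [/\ 0 < gam, 2 * gam <= lam, gam < p0,
    alpha * expR (gam * r) < 1 &
    p0 * expR (gam * r) * (N1 + N2 / (1 - alpha * expR (gam * r))) /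
      (p0 - gam) < 1].
Proof.
move=> al1 lam0 p00 N1N2.
have cid0 : (z @[z --> (0 : R)^'+] --> (0 : R))%classic.
  exact: cvg_within.
have ce : (expR (z * r) @[z --> (0 : R)^'+] --> (1 : R))%classic.
  rewrite -expR0 -[in X in _ --> X](mul0r r).
  apply: continuous_cvg; first exact: continuous_expR.
  exact: cvgMl.
have cae : (alpha * expR (z * r) @[z --> (0 : R)^'+] --> alpha)%classic.
  by rewrite -[in X in _ --> X](mulr1 alpha); exact: cvgMr.
have al0 : 1 - alpha != 0 by rewrite gt_eqF// subr_gt0.
have ck : (p0 * expR (z * r) * (N1 + N2 / (1 - alpha * expR (z * r))) /
    (p0 - z) @[z --> (0 : R)^'+] -->
    p0 * 1 * (N1 + N2 / (1 - alpha)) / (p0 - 0))%classic.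
  apply: cvgM; last first.
    apply: cvgV; first by rewrite subr0 gt_eqF.
    by apply: cvgB => //; exact: cvg_cst.
  apply: cvgM; first by apply: cvgMr.
  apply: cvgD; first exact: cvg_cst.
  apply: cvgMr; apply: cvgV => //.
  by apply: cvgB => //; exact: cvg_cst.
have k1 : p0 * 1 * (N1 + N2 / (1 - alpha)) / (p0 - 0) < 1.
  by rewrite mulr1 subr0 mulrAC divff ?gt_eqF// mul1r.
near (0 : R)^'+ => gam; exists gam; split.
- by near: gam; exact: nbhs_right_gt.
- rewrite mulrC -ler_pdivlMr//; near: gam; apply: nbhs_right_le.
  by rewrite divr_gt0.
- by near: gam; exact: nbhs_right_lt.
- by near: gam; exact: cvgr_lt cae _ al1.
- by near: gam; exact: cvgr_lt ck _ k1.
Unshelve. all: by end_near. Qed.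

(** The part of [is_solution] that enters the estimates, with the initial
    function replaced by a bound [Phi] and the derivative in relational form. *)
Definition estimable_solution (R : realType) (a b g h : R -> R)
    (sigma Phi : R) (x : R -> R) : Prop :=
  [/\ forall t, t <= sigma -> `|x t| <= Phi,
      forall T, exists S0 : R, \forall t \ae @lebesgue_measure R,
        sigma <= t <= T -> `|x t| <= S0,
      locally_abs_continuous sigma (fun t => x t - a t * x (g t)) &
      \forall t \ae @lebesgue_measure R, sigma <= t ->
        is_derive t 1 (fun t => x t - a t * x (g t)) (- (b t * x (h t)))].

(** Estimates on segments suffice, as a half-line is a countable union of them
    and the constants are common to all. *)
Lemma exponentially_stable_of_segments (R : realType) (a b g h : R -> R)
    (t0 tau M gam : R) :
  0 < gam ->
  (forall (sigma Phi : R) (x : R -> R), t0 <= sigma ->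
     estimable_solution a b g h sigma Phi x ->
     forall T, sigma + tau <= T ->
     \forall t \ae @lebesgue_measure R, sigma <= t <= T ->
       `|x t| <= M * Phi * expR (- gam * (t - sigma))) ->
  exponentially_stable t0 a b g h.
Proof.
(* The maximum with 1 only serves to have a positive constant. *)
move=> gam0 H; exists (Num.max 1 M), gam.
split => //; first by rewrite lt_max ltr01.
move=> sigma phi x st0 [_ bphi] [_ xb yac xeq xphi].
set Phi := sup _.
have Phib t : t <= sigma -> `|x t| <= Phi.
  move=> ts; rewrite xphi//; apply: ub_le_sup; last first.
    by exists t => //=; rewrite in_itv/=.
  have [K [_ hK]] := bphi; exists (K + 1) => _ [z zs <-].
  by apply: (hK (K + 1)) => //; rewrite ltrDl.
have Phi0 : 0 <= Phi by exact: le_trans (Phib _ (lexx _)).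
have xb' T : exists S0 : R, \forall t \ae @lebesgue_measure R,
    sigma <= t <= T -> `|x t| <= S0.
  have [c _ [_ hc]] := ess_norm_fin (xb T); exists c.
  by apply: ae_mono hc => t ht tT; apply: ht; rewrite /= in_itv.
have yeq : \forall t \ae @lebesgue_measure R, sigma <= t ->
    is_derive t 1 (fun t => x t - a t * x (g t)) (- (b t * x (h t))).
  apply: ae_mono xeq => t ht st; have [dy yE] := ht st.
  apply: DeriveDef => //; rewrite -derive1E; apply/eqP.
  by rewrite -addr_eq0 yE.
have {}H := H sigma Phi x st0 (And4 Phib xb' yac yeq).
have : \forall t \ae @lebesgue_measure R, forall n : nat,
    sigma <= t <= sigma + tau + n%:R ->
    `|x t| <= M * Phi * expR (- gam * (t - sigma)).
  by apply: ae_foralln => n; apply: H; rewrite lerDl ler0n.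
apply: ae_mono => t ht st.
have : exists n : nat, t <= sigma + tau + n%:R.
  exists (Num.truncn `|t - (sigma + tau)|).+1.
  rewrite -lerBlDl; apply: le_trans (ler_norm _) _; apply: ltW.
  exact: truncnS_gt.
move=> [n tn]; apply: le_trans (ht n _) _; first by rewrite st.
rewrite [leRHS]mulrAC ler_wpM2r ?expR_ge0// ler_wpM2r//.
by rewrite le_max lexx orbT.
Qed.

(** * Stability criteria *)

Section stability.
Context {R : realType} (a b g h : R -> R) (t0 alpha B delta tau : R).
Hypotheses (t00 : 0 <= t0) (delta0 : 0 < delta) (tau0 : 0 < tau)
  (B0 : 0 < B) (alpha01 : 0 <= alpha < 1)
  (gN : null_preimages g) (hN : null_preimages h)
  (g_le : forall t, 0 <= t -> g t <= t)
  (h_le : \forall t \ae @lebesgue_measure R, 0 <= t -> h t <= t)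
  (g_delay : \forall t \ae @lebesgue_measure R, t0 <= t -> t - g t <= delta)
  (h_delay : \forall t \ae @lebesgue_measure R, t0 <= t -> t - h t <= tau)
  (a_le : forall t, t0 <= t -> `|a t| <= alpha)
  (b_le : \forall t \ae @lebesgue_measure R, t0 <= t -> `|b t| <= B).

Let ae_later sigma (P : R -> Prop) : t0 <= sigma ->
  (\forall t \ae @lebesgue_measure R, t0 <= t -> P t) ->
  \forall t \ae @lebesgue_measure R, sigma <= t -> P t.
Proof.
by move=> ts; apply: ae_mono => t ht st; apply: ht; exact: le_trans st.
Qed.

(** The small-gain criterion: [N1] and [N2] are the gains from the weighted
    bounds of [y] and of [x] to that of the forcing term, and [1 / (1 - alpha)]
    is the gain from [y] to [x]. *)
Lemma exponentially_stable_criterion (k p : R -> R) (lam p0 N1 N2 : R) :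
  0 < lam -> 0 < p0 -> 0 <= N1 -> 0 <= N2 -> N1 + N2 / (1 - alpha) < 1 ->
  (\forall t \ae @lebesgue_measure R, t0 + tau <= t ->
     [/\ t - tau <= k t <= t, p0 <= p t &
         p t * expR (lam * (t - k t)) <= lam]) ->
  (forall (sigma Phi gam T Y S : R) (x : R -> R),
     t0 <= sigma -> estimable_solution a b g h sigma Phi x ->
     0 <= gam -> Phi <= S -> 0 <= Y ->
     (forall t, sigma <= t <= T ->
        `|x t - a t * x (g t)| <= Y * expR (- gam * (t - sigma))) ->
     (\forall t \ae @lebesgue_measure R, sigma <= t <= T ->
        `|x t| <= S * expR (- gam * (t - sigma))) ->
     \forall t \ae @lebesgue_measure R, sigma + tau <= t <= T ->
       `|x (k t) - a (k t) * x (g (k t)) - b t / p t * x (h t)| <=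
         expR (gam * (2 * (tau + delta))) * (N1 * Y + N2 * S) *
           expR (- gam * (t - sigma))) ->
  exponentially_stable t0 a b g h.
Proof.
move=> lam0 p00 N10 N20 N12 kp f_le; have /andP[al0 al1] := alpha01.
have [gam [gam0 gl gp ae1 kap1]] :=
  small_rate_exists (2 * (tau + delta)) al1 lam0 p00 N12.
eapply (exponentially_stable_of_segments (tau := tau)); first exact: gam0.
move=> sigma Phi x ts xsol T sT; have [x1 x2 x3 x4] := xsol.
have s0 : 0 <= sigma by exact: le_trans ts.
apply: (solution_decay s0 delta0 tau0 B0 alpha01 gN hN g_le h_le
  (ae_later ts g_delay) (ae_later ts h_delay) _ (ae_later ts b_le)
  x1 x2 x3 x4 lam0 p00 N10 N20 gam0 gl gp ae1 kap1 (k := k) (p := p)) => //.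
- by move=> t st; apply: a_le; exact: le_trans st.
- apply: ae_mono kp => t ht st.
  have [|/andP[k1 k2] p1 p2] := ht; first by rewrite (le_trans _ st)// lerD2r.
  by split=> //; rewrite k2 andbT (le_trans _ k1)// lerBrDr.
- move=> T' Y S PS Y0 yY xS.
  exact: (f_le sigma Phi gam T' Y S x ts xsol (ltW gam0) PS Y0 yY xS).
Qed.

(** The coefficient [beta] is cut off at [1 / (tau * e)], so that
    [lam = 1 / tau] is admissible in [delay_supersolution_ge0]. *)
Lemma exponentially_stable_small_coefficient (beta : R -> R) (N1 N2 b1 : R) :
  0 < b1 -> 0 <= N1 -> 0 <= N2 -> N1 + N2 * (alpha / (1 - alpha)) < 1 ->
  (\forall t \ae @lebesgue_measure R, t0 <= t ->
     [/\ b1 <= beta t <= (tau * expR 1)^-1,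
         `|(b t - beta t) / beta t| <= N1 & `|b t / beta t| <= N2]) ->
  exponentially_stable t0 a b g h.
Proof.
move=> b10 N10 N20 N12 hb; have /andP[al0 al1] := alpha01.
apply: (@exponentially_stable_criterion h beta tau^-1 b1 N1 (N2 * alpha)) => //.
- by rewrite invr_gt0.
- exact: mulr_ge0.
- by rewrite -mulrA.
- apply: ae_mono (ae_and (ae_and h_le h_delay) hb) => t [[h1 h2] h3] tt.
  have t0t : t0 <= t by apply: le_trans tt; rewrite lerDl ltW.
  have [/andP[b1b bt] _ _] := h3 t0t; have {}h2 := h2 t0t.
  have ht : h t <= t by apply: h1; exact: le_trans t0t.
  split => //; first by rewrite ht andbT lerBlDr -lerBlDl.
  apply: (@le_trans _ _ ((tau * expR 1)^-1 * expR 1)).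
    apply: ler_pM => //; rewrite ?expR_ge0//.
      by apply: le_trans b1b; exact: ltW.
    by rewrite ler_expR ler_pdivrMl// mulr1.
  by rewrite invfM -mulrA mulVf ?mulr1// gt_eqF// expR_gt0.
- move=> sigma Phi gam T Y S x ts [x1 x2 x3 x4] gam0 PS Y0 yY xS.
  have s0 : 0 <= sigma by exact: le_trans ts.
  apply: (perturbation_small_coefficient s0 delta0 tau0 gN hN g_le h_le
    (ae_later ts g_delay) (ae_later ts h_delay) _ x1 gam0 PS xS _ Y0 yY).
    by move=> t st; apply: a_le; exact: le_trans st.
  apply: ae_mono hb => t ht st.
  have [|/andP[b1b _] bN1 bN2] := ht; first exact: le_trans st.
  by split=> //; rewrite gt_eqF// (lt_le_trans b10).
Qed.

(** The delay is cut off at [1 / (B * e)], so that [lam = B * e] is admissible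
    in [delay_supersolution_ge0]; the gains are [N1 = 0] and
    [N2 = B * N + alpha]. *)
Lemma exponentially_stable_small_delay (N b0 : R) :
  0 < b0 -> 0 <= N -> B * N < 1 - 2 * alpha ->
  (\forall t \ae @lebesgue_measure R, t0 <= t ->
     b0 <= b t /\ Num.max (t - h t - (B * expR 1)^-1) 0 <= N) ->
  exponentially_stable t0 a b g h.
Proof.
move=> b00 N0 BN hb; have /andP[al0 al1] := alpha01.
pose r := (B * expR 1)^-1.
have r0 : 0 < r by rewrite invr_gt0 mulr_gt0 ?expR_gt0.
apply: (@exponentially_stable_criterion
  (fun t => Num.max (h t) (t - r)) b (B * expR 1) b0 0 (B * N + alpha)) => //.
- by rewrite mulr_gt0 ?expR_gt0.
- by rewrite addr_ge0// mulr_ge0// ltW.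
- by rewrite add0r ltr_pdivrMr ?subr_gt0// mul1r; lra.
- apply: ae_mono (ae_and (ae_and (ae_and h_le h_delay) b_le) hb) => t.
  move=> [[[h1 h2] h3] h4] tt.
  have t0t : t0 <= t by apply: le_trans tt; rewrite lerDl ltW.
  have [b0b _] := h4 t0t; have {}h2 := h2 t0t.
  have ht : h t <= t by apply: h1; exact: le_trans t0t.
  split => //.
    rewrite le_max ge_max ht gerBl (ltW r0) !andbT.
    by apply/orP; left; rewrite lerBlDr -lerBlDl.
  apply: ler_pM; [|exact: expR_ge0| |].
  + by apply: le_trans b0b; exact: ltW.
  + by apply: le_trans (h3 t0t); exact: ler_norm.
  + rewrite ler_expR -ler_pdivlMl ?mulr_gt0 ?expR_gt0// mulr1 -/r.
    by rewrite lerBlDr -lerBlDl le_max lexx orbT.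
- move=> sigma Phi gam T Y S x ts [x1 x2 x3 x4] gam0 PS Y0 yY xS.
  have s0 : 0 <= sigma by exact: le_trans ts.
  rewrite mul0r add0r.
  apply: (perturbation_small_delay s0 delta0 tau0 B0 gN hN g_le h_le
    (ae_later ts g_delay) (ae_later ts h_delay) _ (ae_later ts b_le)
    x1 x3 x4 gam0 PS xS (ltW r0) N0).
    by move=> t st; apply: a_le; exact: le_trans st.
  apply: ae_mono hb => t ht st.
  have [|b0b bN] := ht; first exact: le_trans st.
  by split=> //; rewrite gt_eqF// (lt_le_trans b00).
Qed.

End stability.

(** * The theorem *)

(* [g t <= t] is required at every [t >= 0], like the bound on [|a t|]: the
   initial value [phi sigma - a sigma * phi (g sigma)] is read at one point.
   [fine] is only applied to [ess_norm] of [a] and [b], which are finite. *)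
Theorem theorem3p3 (R : realType) (a b g h : R -> R)
    (t0 a0 delta tau b0 : R)
    (ma : lebesgue_measurable_fun `[0, +oo[ a)
    (mb : lebesgue_measurable_fun `[0, +oo[ b)
    (mg : lebesgue_measurable_fun `[0, +oo[ g)
    (mh : lebesgue_measurable_fun `[0, +oo[ h)
    (bda : ess_bounded `[0, +oo[ a)
    (bdb : ess_bounded `[0, +oo[ b)
    (lbg : locally_ess_bounded 0 g)
    (lbh : locally_ess_bounded 0 h)
    (g_le : forall t, 0 <= t -> g t <= t)
    (h_le : \forall t \ae @lebesgue_measure R, 0 <= t -> h t <= t)
    (g_lim : g t @[t --> +oo] --> +oo)
    (h_lim : h t @[t --> +oo] --> +oo)
    (g_null : null_preimages g)
    (h_null : null_preimages h)
    (b_ge0 : \forall t \ae @lebesgue_measure R, 0 <= t -> 0 <= b t)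
    (t0_ge0 : 0 <= t0) (a0_lt1 : a0 < 1)
    (delta_gt0 : 0 < delta) (tau_gt0 : 0 < tau) (b0_gt0 : 0 < b0)
    (a_rep : forall t, t0 <= t -> (`|a t|%R%:E <= ess_norm `[t0, +oo[ a)%E)
    (a_le : (ess_norm `[t0, +oo[ a <= a0%:E)%E)
    (g_delay : \forall t \ae @lebesgue_measure R, t0 <= t -> t - g t <= delta)
    (h_delay : \forall t \ae @lebesgue_measure R, t0 <= t -> t - h t <= tau)
    (b_ge : \forall t \ae @lebesgue_measure R, t0 <= t -> b0 <= b t) :
  let norm_a := fine (ess_norm `[t0, +oo[ a) in
  let norm_b := fine (ess_norm `[t0, +oo[ b) in
  let beta := fun t => Num.min (b t) (1 / (tau * expR 1)) in
  (ess_norm `[t0, +oo[ (fun t => ((b t - beta t) / beta t)%R)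
     + ess_norm `[t0, +oo[ (fun t => (b t / beta t)%R)
       * (norm_a / (1 - norm_a))%R%:E < 1)%E
  \/
  (norm_b%:E
     * ess_norm `[t0, +oo[
         (fun t => Num.max (t - h t - 1 / (norm_b * expR 1)) 0)%R
   < (1 - 2 * norm_a)%R%:E)%E ->
  exponentially_stable t0 a b g h.
Proof.
move=> norm_a norm_b beta.
have [alpha aE [al0 _]] : exists2 c : R, ess_norm `[t0, +oo[ a = c%:E &
    0 <= c /\ \forall t \ae @lebesgue_measure R,
      `[t0, +oo[%classic t -> `|a t| <= c.
  by apply: ess_norm_fin; rewrite (le_lt_trans a_le)// ltry.
have naE : norm_a = alpha by rewrite /norm_a aE.
have al1 : alpha < 1 by apply: le_lt_trans a0_lt1; rewrite -lee_fin -aE.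
have a_le' t : t0 <= t -> `|a t| <= alpha by move=> /a_rep; rewrite aE lee_fin.
have al01 : 0 <= alpha < 1 by rewrite al0.
have [B bE [Bge0 b_le]] : exists2 c : R, ess_norm `[t0, +oo[ b = c%:E &
    0 <= c /\ \forall t \ae @lebesgue_measure R,
      `[t0, +oo[%classic t -> `|b t| <= c.
  apply: ess_norm_fin; have [c _ [c0 hc]] := ess_norm_fin bdb.
  apply: le_lt_trans (ltry c); apply/ess_norm_leP => //.
  apply: ae_mono hc => t ht; rewrite /= in_itv/= andbT => tt.
  by apply: ht; rewrite /= in_itv/= andbT (le_trans t0_ge0).
have nbE : norm_b = B by rewrite /norm_b bE.
have b_le' : \forall t \ae @lebesgue_measure R, t0 <= t -> `|b t| <= B.
  by apply: ae_mono b_le => t ht tt; apply: ht; rewrite /= in_itv/= andbT.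
have B0 : 0 < B.
  have [|t bB] := @ae_ge_exists R t0 (fun=> b0 <= B); last first.
    exact: lt_le_trans bB.
  apply: ae_mono (ae_and b_ge b_le') => t [h1 h2] tt.
  by apply: le_trans (h1 tt) (le_trans (ler_norm _) (h2 tt)).
rewrite naE nbE => -[cond|cond].
  set E1 := ess_norm _ _ in cond.
  set E2 := ess_norm _ (fun t => b t / beta t) in cond.
  have te0 : 0 < (tau * expR 1)^-1 by rewrite invr_gt0 mulr_gt0 ?expR_gt0.
  pose b1 := Num.min b0 (tau * expR 1)^-1.
  have b10 : 0 < b1 by rewrite lt_min b0_gt0.
  have b1_le : \forall t \ae @lebesgue_measure R, t0 <= t ->
      b1 <= beta t <= (tau * expR 1)^-1.
    apply: ae_mono b_ge => t /[apply] b0b.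
    rewrite /beta div1r; apply/andP; split; last by rewrite ge_min lexx orbT.
    by rewrite le_min !ge_min b0b lexx orbT.
  have q0 : (0 <= (alpha / (1 - alpha))%:E)%E.
    by rewrite lee_fin divr_ge0// subr_ge0 ltW.
  have E10 : (0 <= E1)%E by exact: ess_norm_ge0.
  have E20 : (0 <= E2)%E by exact: ess_norm_ge0.
  have [N1 E1E [N10 hN1]] : exists2 c : R, E1 = c%:E &
      0 <= c /\ \forall t \ae @lebesgue_measure R, `[t0, +oo[%classic t ->
        `|(b t - beta t) / beta t| <= c.
    apply: ess_norm_fin; apply: (@lt_trans _ _ 1%E); last exact: ltry.
    by apply: le_lt_trans cond; rewrite leeDl// mule_ge0.
  (* [E2] is finite by the lower bound of [beta], even when [norm_a] is 0 and
     the condition does not see it. *)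
  have [N2 E2E [N20 hN2]] : exists2 c : R, E2 = c%:E &
      0 <= c /\ \forall t \ae @lebesgue_measure R, `[t0, +oo[%classic t ->
        `|b t / beta t| <= c.
    apply: ess_norm_fin; apply: le_lt_trans (ltry (B / b1)).
    apply/ess_norm_leP; first by rewrite divr_ge0// ltW.
    apply: ae_mono (ae_and b_le b1_le) => t [h1 h2] tt.
    have := tt; rewrite /= in_itv/= andbT => /h2 /andP[b1b _].
    rewrite normrM normfV; apply: ler_pM => //; first exact: h1.
    have bt0 : 0 < beta t by exact: lt_le_trans b1b.
    by rewrite gtr0_norm// lef_pV2// posrE.
  apply: (@exponentially_stable_small_coefficient R a b g h t0 alpha B delta tau
    _ _ _ _ _ _ _ _ _ _ _ _ _ beta N1 N2 b1) => //.
    by move: cond; rewrite E1E E2E -EFinM -EFinD lte_fin.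
  apply: ae_mono (ae_and (ae_and hN1 hN2) b1_le) => t [[h1 h2] h3] tt.
  have tt' : `[t0, +oo[%classic t by rewrite /= in_itv/= andbT.
  by split; [exact: h3|exact: h1|exact: h2].
set E := ess_norm _ _ in cond.
have E0 : (0 <= E)%E by exact: ess_norm_ge0.
have [N EE [N0 hN]] : exists2 c : R, E = c%:E &
    0 <= c /\ \forall t \ae @lebesgue_measure R, `[t0, +oo[%classic t ->
      `|Num.max (t - h t - 1 / (B * expR 1)) 0| <= c.
  apply: ess_norm_fin; rewrite -/E ltNge leye_eq; apply/negP => /eqP Eoo.
  by move: cond; rewrite Eoo gt0_muley ?lte_fin// ltNge leey.
apply: (@exponentially_stable_small_delay R a b g h t0 alpha B delta tau
  _ _ _ _ _ _ _ _ _ _ _ _ _ N b0) => //.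
  by move: cond; rewrite EE -EFinM lte_fin.
apply: ae_mono (ae_and b_ge hN) => t [h1 h2] tt; split; first exact: h1.
have := h2; rewrite div1r /= in_itv/= andbT => /(_ tt).
by apply: le_trans; exact: ler_norm.
Qed.
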